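(* Let $\xi_i$ be i.i.d. Gaussian $\mathcal N(0,\sigma^2)$ random variables with $\sigma^2>0$, and assume $\beta\ge4\sigma^2$ and $\mathrm{Tr}(\Phi)>0$. Set $\tau=\frac{\sigma}{\sqrt{n\,\mathrm{Tr}(\Phi)}}$, and let $\hat f_n$ be the exponentially weighted aggregate on $\Lambda=\mathbb R^M$ with temperature $\beta$ and prior $\pi(d\lambda)=q(\lambda)\,d\lambda$. Then for all $\lambda^*\in\mathbb R^M$ we have $$E\big(\|\hat f_n-f\|_n^2\big)\le\|f_{\lambda^*}-f\|_n^2+\frac{4\beta M(\lambda^* )}{n}\Big(1+\log_+\Big\{\frac{\sqrt{n\,\mathrm{Tr}(\Phi)}}{M(\lambda^* )\,\sigma}\,|\lambda^*|_1\Big\}\Big)+\frac{\sigma^2}{n},$$ where $|\lambda^*|_1=\sum_{j=1}^M|\lambda_j^*|$ and the second term on the right is interpreted as $0$ when $\lambda^*=0$.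
   Context: Model: $Y_i=f(x_i)+\xi_i$, $i=1,\dots,n$, where $x_1,\dots,x_n$ are non-random elements of a set $\mathcal X$ and $f:\mathcal X\to\mathbb R$ is an unknown function. Write $\mathbf Y=(Y_1,\dots,Y_n)$. Functions $\phi_1,\dots,\phi_M:\mathcal X\to\mathbb R$ are given, and $f_\lambda=\sum_{j=1}^M\lambda_j\phi_j$ for $\lambda\in\mathbb R^M$. $\Phi$ is the $M\times M$ Gram matrix with entries $\Phi_{j,j'}=\frac1n\sum_{i=1}^n\phi_j(x_i)\phi_{j'}(x_i)$, and $\mathrm{Tr}(\Phi)$ its trace. $M(\lambda)$ is the number of non-zero components of $\lambda$. $\log_+x=\max(\log x,0)$ for $x>0$ (and $\log_+0=0$). For functions $g,h$ on $\mathcal X$, $\|g-h\|_n^2=\frac1n\sum_{i=1}^n(g(x_i)-h(x_i))^2$; for $\mathbf y\in\mathbb R^n$, $\|\mathbf y-f_\lambda\|_n^2=\frac1n\sum_{i=1}^n(y_i-f_\lambda(x_i))^2$. Sparsity prior (case $L_0=\infty$): $q(\lambda)=\prod_{j=1}^M\tau^{-1}q_0(\lambda_j/\tau)$, $\lambda\in\mathbb R^M$, with $q_0(t)=\frac{3}{2(1+|t|)^4}$, $t\in\mathbb R$. The exponentially weighted aggregate with prior $\pi$ and temperature $\beta$ is $$\hat f_n(x)=\int_{\mathbb R^M}\theta_\lambda(\mathbf Y)f_\lambda(x)\,\pi(d\lambda),\qquad\theta_\lambda(\mathbf Y)=\frac{\exp\{-n\|\mathbf Y-f_\lambda\|_n^2/\beta\}}{\int_{\mathbb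 R^M}\exp\{-n\|\mathbf Y-f_w\|_n^2/\beta\}\,\pi(dw)}.$$ *)

(* Defs.v *)
From HB Require Import structures.
From mathcomp Require Import all_boot all_order all_algebra.
From mathcomp Require Import all_classical all_reals all_analysis.
From mathcomp Require Import measurable_realfun.

Set Implicit Arguments.
Unset Strict Implicit.
Unset Printing Implicit Defensive.

Import Order.TTheory GRing.Theory Num.Theory.
Import numFieldNormedType.Exports.

Local Open Scope classical_set_scope.
Local Open Scope ring_scope.

(* Vectors of R^M are tuples [M.-tuple R], which carry the product of the Borel
   sigma-algebras. Lebesgue measure on them is the iterated product of
   [lebesgue_measure], transported along (x, t) |-> x :: t. *)
Section lebesgue_tuple.
Context {R : realType}.

Definition tuple_of_pair (n : nat) (p : measurableTypeR R * n.-tuple R) : n.+1.-tuple R :=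
  [tuple of p.1 :: p.2].

Definition pair_of_tuple (n : nat) (t : n.+1.-tuple R) :
    measurableTypeR R * n.-tuple R :=
  (thead t, [tuple of behead t]).

Lemma tuple_of_pairK n : cancel (@tuple_of_pair n) (@pair_of_tuple n).
Proof.
by move=> [x t]; rewrite /pair_of_tuple /tuple_of_pair/= theadE; congr pair;
  exact: val_inj.
Qed.

Lemma measurable_tuple_of_pair n : measurable_fun setT (@tuple_of_pair n).
Proof. exact: measurable_cons. Qed.

Lemma measurable_pair_of_tuple n : measurable_fun setT (@pair_of_tuple n).
Proof.
apply/measurable_fun_pairP; split; last exact: measurable_behead.
exact: measurable_tnth.
Qed.

Section step.
Context (n : nat) (m : {sigma_finite_measure set (n.-tuple R) -> \bar R}).

Definition lebesgue_cons : set (n.+1.-tuple R) -> \bar R :=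
  pushforward (@lebesgue_measure R \x m)%E (@tuple_of_pair n).

Let lebesgue_cons0 : lebesgue_cons set0 = 0%E.
Proof. by rewrite /lebesgue_cons /pushforward preimage_set0 measure0. Qed.

Let lebesgue_cons_ge0 A : (0 <= lebesgue_cons A)%E.
Proof. by rewrite /lebesgue_cons /pushforward; apply: measure_ge0. Qed.

Let lebesgue_cons_sigma_additive : semi_sigma_additive lebesgue_cons.
Proof.
have mpre A : measurable A -> measurable (@tuple_of_pair n @^-1` A).
  move=> mA; rewrite -[X in measurable X]setTI.
  exact: measurable_tuple_of_pair.
move=> F mF tF mUF; rewrite /lebesgue_cons /pushforward preimage_bigcup.
apply: measure_semi_sigma_additive.
- by move=> k; exact: mpre.
- apply/trivIsetP => /= i j _ _ ij; rewrite -preimage_setI.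
  by move/trivIsetP : tF => /(_ _ _ _ _ ij) ->//; rewrite preimage_set0.
- by rewrite -preimage_bigcup; exact: mpre.
Qed.

HB.instance Definition _ := isMeasure.Build _ _ _ lebesgue_cons
  lebesgue_cons0 lebesgue_cons_ge0 lebesgue_cons_sigma_additive.

Let lebesgue_cons_sigma_finite : sigma_finite setT lebesgue_cons.
Proof.
have /sigma_finiteP[F [TF ndF Foo]] := sigma_finiteT (@lebesgue_measure R).
have /sigma_finiteP[G [TG ndG Goo]] := sigma_finiteT m.
exists (fun k => @pair_of_tuple n @^-1` (F k `*` G k)).
  rewrite -preimage_bigcup (_ : \bigcup_k _ = setT) ?preimage_setT//.
  apply/seteqP; split => // -[x y] _.
  have [i _ Fx] : (\bigcup_i F i) x by rewrite -TF.
  have [j _ Gy] : (\bigcup_j G j) y by rewrite -TG.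
  exists (maxn i j) => //; split => /=.
  - by move: x Fx; exact/subsetPset/ndF/leq_maxl.
  - by move: y Gy; exact/subsetPset/ndG/leq_maxr.
move=> k; have [mF Fk] := Foo k; have [mG Gk] := Goo k; split.
  rewrite -[X in measurable X]setTI; apply: measurable_pair_of_tuple => //.
  exact: measurableX.
rewrite /lebesgue_cons /pushforward -comp_preimage.
rewrite (_ : _ \o _ = id) ?preimage_id; last first.
  by apply/funext => p; exact: tuple_of_pairK.
by rewrite product_measure1E// lte_mul_pinfty// ge0_fin_numE.
Qed.

HB.instance Definition _ := Measure_isSigmaFinite.Build _ _ _ lebesgue_cons
  lebesgue_cons_sigma_finite.

End step.

Fixpoint lebesgue_tuple (n : nat) :
    {sigma_finite_measure set (n.-tuple R) -> \bar R} :=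
  if n is n'.+1 then lebesgue_cons (lebesgue_tuple n')
  else \d_([tuple] : 0.-tuple R).

Lemma lebesgue_tuple_box n (A : 'I_n -> set R) :
  (forall i, measurable (A i)) ->
  lebesgue_tuple n [set t | forall i, A i (tnth t i)] =
  (\prod_(i < n) lebesgue_measure (A i))%E.
Proof.
elim: n A => [|n IHn] A mA.
  rewrite big_ord0 (_ : [set t | _] = setT); first exact: diracT.
  by apply/seteqP; split => // t _ [].
rewrite big_ord_recl -IHn// -product_measure1E//=; last first.
  rewrite (_ : [set t | _] = \bigcap_(i in [set: 'I_n])
      ((@tnth _ R ^~ i) @^-1` A (lift ord0 i))); last first.
    apply/seteqP; split => t /= h i; first by move=> _; exact: h.
    exact: (h i Logic.I).
  apply: fin_bigcap_measurable => [|i _]; first exact: finite_finset.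
  by rewrite -[X in measurable X]setTI; exact: measurable_tnth.
  exact: mA.
rewrite /lebesgue_cons /pushforward; congr (_ _); apply/seteqP; split.
  move=> [x t] /= h; split; first exact: (h ord0).
  by move=> i; have := h (lift ord0 i); rewrite /tuple_of_pair/= tnthS.
move=> [x t] /= [Ax At] i; rewrite /tuple_of_pair/=.
by have [j ->|->] := unliftP ord0 i; [rewrite tnthS|].
Qed.

End lebesgue_tuple.

Section independence.
Context d (T : measurableType d) (R : realType) (P : probability T R).

Definition mutually_independent (I : finType) (X : I -> {RV P >-> R}) : Prop :=
  forall (J : {set I}) (B : I -> set R), (forall i, measurable (B i)) ->
    P (\bigcap_(i in [set` J]) (X i @^-1` B i)) =
    (\prod_(i in J) P (X i @^-1` B i))%E.

(* The last parameter of [normal_prob] is the standard deviation. *)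
Definition centered_gaussian (sigma : R) (X : {RV P >-> R}) : Prop :=
  forall A : set R, measurable A ->
    distribution P X A = normal_prob 0 sigma A.

End independence.

Section regression.
Context {R : realType}.

(* ||g - h||_n^2 is [sqnorm_dist (g \o x) (h \o x)], with [x] the design. *)
Definition sqnorm_dist (n : nat) (u v : 'I_n -> R) : R :=
  n%:R^-1 * \sum_(i < n) (u i - v i) ^+ 2.

Definition lincomb (X : Type) (M : nat) (phi : 'I_M -> X -> R)
    (lambda : M.-tuple R) (z : X) : R :=
  \sum_(j < M) tnth lambda j * phi j z.

Definition gram (X : Type) (n M : nat) (x : 'I_n -> X) (phi : 'I_M -> X -> R) :
    'M[R]_M :=
  \matrix_(j, k) (n%:R^-1 * \sum_(i < n) phi j (x i) * phi k (x i)).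

Definition nb_nonzero (M : nat) (lambda : M.-tuple R) : nat :=
  #|[set j : 'I_M | tnth lambda j != 0]|.

Definition l1norm (M : nat) (lambda : M.-tuple R) : R :=
  \sum_(j < M) `|tnth lambda j|.

(* As [ln t = 0] for [t <= 0], [log_plus 0 = 0]; since moreover [0^-1 = 0], a
   term [nb_nonzero lambda * (1 + log_plus (_ / nb_nonzero lambda * _))] is [0]
   at [lambda = 0]. *)
Definition log_plus (t : R) : R := Num.max (ln t) 0.

End regression.

Section prior.
Context {R : realType}.

Definition q0 (t : R) : R := 3 / (2 * (1 + `|t|) ^+ 4).

Definition sparsity_density (M : nat) (tau : R) (lambda : M.-tuple R) : R :=
  \prod_(j < M) (tau^-1 * q0 (tnth lambda j / tau)).

Lemma q0_ge0 t : 0 <= q0 t.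
Proof. by rewrite divr_ge0// mulr_ge0// exprn_ge0// addr_ge0. Qed.

Lemma measurable_q0 : measurable_fun setT q0.
Proof.
apply: continuous_measurable_fun => t.
apply: cvgM; [exact: cvg_cst|apply: cvgV].
  by rewrite lt0r_neq0// mulr_gt0// exprn_gt0// ltr_wpDr.
apply: cvgM; [exact: cvg_cst|].
apply: (@continuous_comp _ _ _ (fun u : R => 1 + `|u|) (fun u => u ^+ 4)).
  by apply: cvgD; [exact: cvg_cst|exact: norm_continuous].
exact: exprn_continuous.
Qed.

Lemma sparsity_density_ge0 M (tau : {posnum R}) (lambda : M.-tuple R) :
  0 <= sparsity_density tau%:num lambda.
Proof. by apply: prodr_ge0 => j _; rewrite mulr_ge0// q0_ge0. Qed.

Lemma measurable_sparsity_density M tau :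
  measurable_fun setT (@sparsity_density M tau).
Proof.
apply: measurable_prod => j _; apply: measurable_funM => //.
apply: (measurableT_comp measurable_q0); apply: measurable_funM => //.
exact: measurable_tnth.
Qed.

Section measure.
Context (M : nat) (tau : {posnum R}).

Definition sparsity_prior (A : set (M.-tuple R)) : \bar R :=
  (\int[lebesgue_tuple M]_(lambda in A)
     (sparsity_density tau%:num lambda)%:E)%E.

Let sparsity_prior0 : sparsity_prior set0 = 0%E.
Proof. exact: integral_set0. Qed.

Let sparsity_prior_ge0 A : (0 <= sparsity_prior A)%E.
Proof.
by apply: integral_ge0 => l _; rewrite lee_fin sparsity_density_ge0.
Qed.

Let sparsity_prior_sigma_additive : semi_sigma_additive sparsity_prior.
Proof.
apply: semi_sigma_additive_nng_induced.
  by apply/measurable_EFinP; exact: measurable_sparsity_density.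
by move=> l; rewrite lee_fin sparsity_density_ge0.
Qed.

HB.instance Definition _ := isMeasure.Build _ _ _ sparsity_prior
  sparsity_prior0 sparsity_prior_ge0 sparsity_prior_sigma_additive.

End measure.
End prior.
Arguments sparsity_prior {R} M tau.

Section aggregate.
Context {R : realType} (X : Type) (n M : nat).
Context (x : 'I_n -> X) (phi : 'I_M -> X -> R).
Context (beta : R) (prior : {measure set (M.-tuple R) -> \bar R}).

Definition gibbs (y : 'I_n -> R) (lambda : M.-tuple R) : R :=
  expR (- (n%:R * sqnorm_dist y (lincomb phi lambda \o x)) / beta).

Definition ewa_weight (y : 'I_n -> R) (lambda : M.-tuple R) : R :=
  gibbs y lambda / \int[prior]_w gibbs y w.

Definition ewa (y : 'I_n -> R) (z : X) : R :=
  \int[prior]_lambda (ewa_weight y lambda * lincomb phi lambda z).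

End aggregate.

(* Main.v *)
(** Two facts drive the proof.

    Sharpness: a posterior mean of [a] under Gaussian weights
    [w exp (- (t - a)^2 / beta)] is a differentiable function of the observation
    [t], whose derivative is [2 / beta] times the posterior variance. Stein's
    identity in each coordinate of the noise therefore bounds
    [2 E (xi_i fhat_i)] by [(4 sigma^2 / beta) E V_i <= E V_i], where [V_i] is the
    posterior variance of [f_lambda (x_i)]. On the other hand, nonnegativity of
    the relative entropy of the posterior gives, for every observation [Y],
    [|Y - fhat|^2 + sum_i V_i <= - beta ln Z(Y)], with [Z] the normalising
    integral. Expanding the square and taking expectations cancels the [V_i].

    Sparsity: translating the prior [q] by [lambda*] costs at most the factor
    [prod_j (1 + |lambda*_j| / tau)^4], because [q0] decays polynomially. Jensen's
    inequality under the translated prior, whose second moment is [tau^2], then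
    bounds [- beta ln Z(Y)] by
    [|Y - f_lambda*|^2 + n Tr(Phi) tau^2 + 4 beta sum_j ln (1 + |lambda*_j| / tau)],
    and concavity of [ln] turns the last sum into the stated penalty. *)
From HB Require Import structures.
Require Import Defs.
From mathcomp Require Import all_boot all_order all_algebra.
From mathcomp Require Import all_classical all_reals all_analysis.
From mathcomp Require Import measurable_realfun.
From mathcomp Require Import ring lra.

Set Implicit Arguments.
Unset Strict Implicit.
Unset Printing Implicit Defensive.

Import Order.TTheory GRing.Theory Num.Theory.
Import numFieldNormedType.Exports.

Local Open Scope classical_set_scope.
Local Open Scope ring_scope.

(** * Integration with respect to a density and translations of the line *)

Section density.
Local Open Scope ereal_scope.
Context d (T : measurableType d) (R : realType).
Context (mu nu : {measure set T -> \bar R}) (g : T -> R).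
Hypotheses (mg : measurable_fun setT g) (g0 : forall x, (0 <= g x)%R).
Hypothesis nuE : forall A, measurable A -> nu A = \int[mu]_(x in A) (g x)%:E.

Import HBNNSimple.

(** Both integrals split over the finitely many values of [f], and on each level set the claim is
    [nuE]. *)
Let density_nnsfun (f : {nnsfun T >-> R}) :
  \int[nu]_x (f x)%:E = \int[mu]_x ((f x)%:E * (g x)%:E).
Proof.
under eq_integral do rewrite fimfunE -fsumEFin//.
rewrite ge0_integral_fsum//; last 2 first.
- by move=> r; exact/measurable_EFinP/measurable_funM.
- by move=> r x _; rewrite nnfun_muleindic_ge0.
under [RHS]eq_integral => x _.
  rewrite fimfunE -fsumEFin// ge0_mule_fsuml; last first.
    by move=> r; rewrite nnfun_muleindic_ge0.
  over.
rewrite [RHS]ge0_integral_fsum//; last 2 first.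
- move=> r; apply: emeasurable_funM; apply/measurable_EFinP => //.
  exact: measurable_funM.
- by move=> r x _; rewrite mule_ge0 ?nnfun_muleindic_ge0// lee_fin.
apply: eq_fsbigr => r _; rewrite integralZl_indic_nnsfun// integral_indic//= setIT.
(* Pulling the constant [r] out of the integral requires [0 <= r]; a negative [r] has an empty level
   set, so both terms vanish. *)
have [r0|r0] := ltP r 0%R.
  rewrite preimage_nnfun0// measure0 mule0; apply/esym/integral0_eq => x _.
  by rewrite indic0 mulr0 mul0e.
under [RHS]eq_integral do rewrite EFinM -muleA.
rewrite ge0_integralZl//; last 2 first.
- apply: emeasurable_funM; apply/measurable_EFinP => //.
- by move=> x _; rewrite mule_ge0// lee_fin.
congr (_ * _); rewrite nuE// integral_mkcond/=.
apply: eq_integral => x _; rewrite patchE indicE.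
by case: ifPn => _; rewrite ?mul1e ?mul0e.
Qed.

(** Monotone convergence along simple approximations reduces this to [density_nnsfun]. *)
Lemma ge0_integral_density (f : T -> \bar R) :
  measurable_fun setT f -> (forall x, 0 <= f x) ->
  \int[nu]_x f x = \int[mu]_x (f x * (g x)%:E).
Proof.
move=> mf f0; pose f_ := nnsfun_approx measurableT mf.
have f_f x : (f_ n x)%:E @[n --> \oo] --> f x.
  by apply: cvg_nnsfun_approx => // y _; exact: f0.
have ndf_ x m n : (m <= n)%N -> (f_ m x <= f_ n x)%R.
  by move=> mn; exact/lefP/nd_nnsfun_approx.
transitivity (limn (fun n => \int[nu]_x (f_ n x)%:E)).
  rewrite -monotone_convergence//.
  - by apply: eq_integral => x _; apply/esym/cvg_lim.
  - by move=> n; exact/measurable_EFinP/measurable_funTS.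
  - by move=> n x _; rewrite lee_fin.
  - by move=> x _ m n mn; rewrite lee_fin ndf_.
transitivity (limn (fun n => \int[mu]_x ((f_ n x)%:E * (g x)%:E))).
  by apply: (congr1 (fun u => limn u)); apply/funext => n; exact: density_nnsfun.
rewrite -monotone_convergence//.
- apply: eq_integral => x _; apply/cvg_lim => //.
  by apply: cvgeZr.
- by move=> n; apply: emeasurable_funM; exact/measurable_EFinP/measurable_funTS.
- by move=> n x _; rewrite mule_ge0 ?lee_fin.
- by move=> x _ m n mn; rewrite lee_wpmul2r ?lee_fin ?ndf_.
Qed.

End density.

Section lebesgue_line.
Context {R : realType}.
Local Notation mu := (@lebesgue_measure R).
Local Open Scope ereal_scope.

(** Lebesgue measure is determined by its values on the intervals []a, b]], whose length a
    translation preserves. *)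
Lemma lebesgue_measure_shift (c : R) (A : set R) : measurable A ->
  pushforward mu ((fun x => c + x)%R : _ -> measurableTypeR R) A = mu A.
Proof.
move=> mA; apply/esym.
have mc : measurable_fun setT ((fun x => c + x)%R : R -> measurableTypeR R).
  exact: measurable_funD.
pose phi := (fun x => c + x)%R : R -> measurableTypeR R.
pose phim : {mfun _ >-> _} := HB.pack phi (isMeasurableFun.Build _ _ _ _ phi mc).
apply: (@lebesgue_measure_unique _ (pushforward mu phim)) => //= _ [[a b]] _ <-.
rewrite /pushforward /=.
rewrite (_ : _ @^-1` _ = `](a - c)%R, (b - c)%R]%classic); last first.
  by apply/seteqP; split => x/=; rewrite !in_itv/= ltrBlDl lerBrDl.
rewrite !lebesgue_measure_itv/= !lte_fin ltrD2r.
by case: ifP => // _; rewrite -!EFinB; congr (_%:E); ring.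
Qed.

Lemma ge0_integral_shift (c : R) (f : R -> \bar R) :
  measurable_fun setT f -> (forall x, 0 <= f x) ->
  \int[mu]_x f (c + x)%R = \int[mu]_x f x.
Proof.
move=> mf f0.
have mc : measurable_fun setT ((fun x => c + x)%R : R -> measurableTypeR R).
  exact: measurable_funD.
have <- := @ge0_integral_pushforward _ _ (measurableTypeR R) (measurableTypeR R)
  R _ mc mu setT f measurableT mf (fun x _ => f0 x).
by apply: eq_measure_integral => //= A mA _; exact: lebesgue_measure_shift.
Qed.

Lemma ge0_integral_oppr (f : R -> \bar R) :
  measurable_fun setT f -> (forall x, 0 <= f x) ->
  \int[mu]_x f (- x)%R = \int[mu]_x f x.
Proof.
move=> mf f0.
have mc : measurable_fun setT (-%R : R -> measurableTypeR R).
  exact: measurable_funN.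
have <- := @ge0_integral_pushforward _ _ (measurableTypeR R) (measurableTypeR R)
  R _ mc mu setT f measurableT mf (fun x _ => f0 x).
by apply: eq_measure_integral => //= A mA _; exact: lebesgue_measureN.
Qed.

End lebesgue_line.

(** * The one-dimensional prior *)

Section prior_density.
Context {R : realType} (tau : R).
Hypothesis tau_gt0 : 0 < tau.
Local Notation mu := (@lebesgue_measure R).

Lemma continuous_q0 : continuous (@q0 R).
Proof.
move=> t; apply: cvgM; [exact: cvg_cst|apply: cvgV].
  by rewrite lt0r_neq0// mulr_gt0// exprn_gt0// ltr_wpDr.
apply: cvgM; [exact: cvg_cst|].
apply: (@continuous_comp _ _ _ (fun u : R => 1 + `|u|) (fun u => u ^+ 4)).
  by apply: cvgD; [exact: cvg_cst|exact: norm_continuous].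
exact: exprn_continuous.
Qed.

Definition prior_pdf (x : R) : R := tau^-1 * q0 (x / tau).

Lemma prior_pdf_ge0 x : 0 <= prior_pdf x.
Proof. by rewrite mulr_ge0 ?invr_ge0 ?(ltW tau_gt0)// q0_ge0. Qed.

Lemma prior_pdfN x : prior_pdf (- x) = prior_pdf x.
Proof. by rewrite /prior_pdf /q0 mulNr normrN. Qed.

Lemma continuous_prior_pdf : continuous prior_pdf.
Proof.
move=> x; apply: cvgM; first exact: cvg_cst.
apply: (@continuous_comp _ _ _ (fun u : R => u / tau) q0).
  by apply: cvgM; [exact: cvg_id|exact: cvg_cst].
exact: continuous_q0.
Qed.

Lemma measurable_prior_pdf : measurable_fun setT prior_pdf.
Proof. exact: continuous_measurable_fun continuous_prior_pdf. Qed.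

(** The doubling anticipates the symmetrisation over the whole line. Keeping [b] and [c] free gives
    the total mass and the second moment [tau ^+ 2] at once. *)
Lemma integral_prior_pdf_half b c :
  (\int[mu]_(x in `[0%R, +oo[)
     ((b ^+ 2 + c ^+ 2 * x ^+ 2) *+ 2 * prior_pdf x)%:E)%E =
  (b ^+ 2 + c ^+ 2 * tau ^+ 2)%:E.
Proof.
(* With [z = (x + tau)^-1] and [0 <= x], twice the density is [3 tau^3 z^4]. The derivative of [z^3]
   is [- 3 z^4], and [1 - tau z = x z] has a cube with derivative [3 tau x^2 z^4]. [F] tends to
   [c ^+ 2 * tau ^+ 2] at infinity and equals [- b ^+ 2] at 0. *)
pose F x : R := - b ^+ 2 * tau ^+ 3 * ((x + tau)^-1) ^+ 3 +
            c ^+ 2 * tau ^+ 2 * (1 - tau * (x + tau)^-1) ^+ 3.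
have cvgz : (fun x : R => (x + tau)^-1) x @[x --> +oo] --> (0 : R).
  apply/gtr0_cvgV0; last exact: cvg_addrr.
  by near=> x; rewrite addr_gt0//; near: x; exact: nbhs_pinfty_gt.
have dF (x : R) : 0 <= x -> is_derive x 1 F
    ((b ^+ 2 + c ^+ 2 * x ^+ 2) *+ 2 * prior_pdf x).
  move=> x0; have xt : x + tau != 0 by rewrite gt_eqF// ltr_wpDl.
  have dz : is_derive x 1 (fun x : R => (x + tau)^-1) (- (x + tau) ^- 2).
    have d1 : is_derive x 1 (fun x : R => x + tau) 1.
      by apply: is_derive_eq; rewrite addr0.
    by have := @is_deriveV R (fun x : R => x + tau) x 1 1 xt d1; rewrite scaler1.
  rewrite /F; apply: is_derive_eq.
  rewrite /prior_pdf /q0 ger0_norm ?divr_ge0// ?(ltW tau_gt0)//.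
  rewrite /GRing.scale/=.
  have t0 : tau != 0 by rewrite gt_eqF.
  by field; rewrite t0 (addrC tau) xt.
have -> : (b ^+ 2 + c ^+ 2 * tau ^+ 2)%:E =
    ((c ^+ 2 * tau ^+ 2)%:E - (F 0)%:E)%E.
  rewrite -EFinB /F; congr (_%:E); rewrite add0r.
  by field; rewrite gt_eqF.
apply: ge0_continuous_FTC2y.
- by move=> x _; rewrite mulr_ge0 ?prior_pdf_ge0// -exprMn mulrn_wge0 ?addr_ge0 ?sqr_ge0.
- apply: continuous_subspaceT => x; apply: cvgM; last exact: continuous_prior_pdf.
  apply: cvgMn; apply: cvgD; first exact: cvg_cst.
  by apply: cvgM; [exact: cvg_cst|exact: exprn_continuous].
- rewrite (_ : c ^+ 2 * tau ^+ 2 = - b ^+ 2 * tau ^+ 3 * 0 ^+ 3 +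
            c ^+ 2 * tau ^+ 2 * (1 - tau * 0) ^+ 3); last by ring.
  rewrite /F; apply: cvgD; apply: cvgM; do ?exact: cvg_cst.
    apply: (@cvg_comp _ _ _ (fun x : R => (x + tau)^-1) (fun x => x ^+ 3)
      _ (nbhs (0 : R)) _ cvgz); exact: exprn_continuous.
  apply: (@cvg_comp _ _ _ (fun x : R => 1 - tau * (x + tau)^-1) (fun x => x ^+ 3)
    _ (nbhs (1 - tau * 0))); last exact: exprn_continuous.
  by apply: cvgB; [exact: cvg_cst|apply: cvgM => //; exact: cvg_cst].
- by move=> x x0; have [] := dF _ (ltW x0).
- apply: cvg_at_right_filter.
  have [d0 _] := dF 0 (lexx _).
  exact/differentiable_continuous/derivable1_diffP.
- move=> x; rewrite in_itv/= andbT => x0; rewrite derive1E.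
  by have [_] := dF x (ltW x0).
Unshelve. all: end_near. Qed.

(* Averaging over [x] and [- x] removes the cross term [2 b c x]. *)
Lemma integral_sqr_prior_pdf b c :
  (\int[mu]_x ((b + c * x) ^+ 2 * prior_pdf x)%:E)%E =
  (b ^+ 2 + c ^+ 2 * tau ^+ 2)%:E.
Proof.
have mpdf := measurable_prior_pdf.
have mf (c' : R) : measurable_fun setT (fun x : R => ((b + c' * x) ^+ 2 * prior_pdf x)%:E).
  apply/measurable_EFinP/measurable_funM => //.
  by apply: measurable_funX; apply: measurable_funD => //; exact: measurable_funM.
have f0 (c' x : R) : (0 <= ((b + c' * x) ^+ 2 * prior_pdf x)%:E)%E.
  by rewrite lee_fin mulr_ge0 ?sqr_ge0 ?prior_pdf_ge0.
set I := LHS.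
have IN : I = (\int[mu]_x ((b + (- c) * x) ^+ 2 * prior_pdf x)%:E)%E.
  rewrite /I -ge0_integral_oppr//; apply: eq_integral => x _.
  by rewrite prior_pdfN mulrN mulNr.
have : (I + I = (b ^+ 2 + c ^+ 2 * tau ^+ 2)%:E + (b ^+ 2 + c ^+ 2 * tau ^+ 2)%:E)%E.
  rewrite {2}IN /I -ge0_integralD//; [|exact: mf..].
  transitivity (\int[mu]_x ((b ^+ 2 + c ^+ 2 * x ^+ 2) *+ 2 * prior_pdf x)%:E)%E.
    by apply: eq_integral => x _; rewrite -EFinD; congr (_%:E); ring.
  rewrite ge0_symfun_integralT.
  - by rewrite -set_itvcy integral_prior_pdf_half mule_natl mule2n.
  - by move=> x; rewrite mulr_ge0 ?prior_pdf_ge0// -exprMn mulrn_wge0 ?addr_ge0 ?sqr_ge0.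
  - move=> x; apply: cvgM; last exact: continuous_prior_pdf.
    apply: cvgMn; apply: cvgD; first exact: cvg_cst.
    by apply: cvgM; [exact: cvg_cst|exact: exprn_continuous].
  - by move=> x /=; rewrite prior_pdfN sqrrN.
have : (0 <= I)%E by apply: integral_ge0.
by case: I {IN} => [r| |]//= _ []// rE; congr (_%:E); lra.
Qed.

Lemma integral_prior_pdf : (\int[mu]_x (prior_pdf x)%:E)%E = 1%E.
Proof.
have := integral_sqr_prior_pdf 1 0; rewrite expr0n/= mul0r addr0 expr1n => <-.
by apply: eq_integral => x _; rewrite mul0r addr0 expr1n mul1r.
Qed.

(** Fourth power of the submultiplicativity [1 + |s + x| / tau <= (1 + |s| / tau) (1 + |x| / tau)];
    the polynomial decay of [q0] makes the factor independent of [x]. *)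
Lemma prior_pdf_shift s x :
  prior_pdf x <= (1 + `|s| / tau) ^+ 4 * prior_pdf (s + x).
Proof.
rewrite /prior_pdf (mulrCA _ tau^-1) ler_pM2l ?invr_gt0//.
rewrite /q0 !normrM normfV (gtr0_norm tau_gt0).
have pos (y : R) : 0 < 1 + `|y| / tau.
  by rewrite ltr_wpDr// divr_ge0// ltW.
rewrite [leRHS]mulrA ler_pdivrMr ?mulr_gt0 ?exprn_gt0//.
rewrite [leRHS]mulrAC ler_pdivlMr ?mulr_gt0 ?exprn_gt0//.
rewrite (_ : 3 * (2 * _) = 6 * (1 + `|s + x| / tau) ^+ 4); last by ring.
rewrite [leRHS](_ : _ = 6 * ((1 + `|s| / tau) * (1 + `|x| / tau)) ^+ 4); last by ring.
rewrite ler_pM2l//; apply: lerXn2r; rewrite ?nnegrE ?mulr_ge0// ?(ltW (pos _))//.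
have : `|s + x| / tau <= `|s| / tau + `|x| / tau.
  by rewrite -mulrDl ler_pM2r ?invr_gt0// ler_normD.
have : 0 <= (`|s| / tau) * (`|x| / tau) by rewrite mulr_ge0// divr_ge0// ltW.
by nra.
Qed.

End prior_density.

(** * The product prior *)

Section prior_tuple.
Context {R : realType} (tau : {posnum R}).
Local Notation mu := (@lebesgue_measure R).
Local Notation pdf := (prior_pdf tau%:num).
Local Open Scope ereal_scope.

Lemma ge0_integral_sparsity_prior M (F : M.-tuple R -> \bar R) :
  measurable_fun setT F -> (forall t, 0 <= F t) ->
  \int[sparsity_prior M tau]_t F t =
  \int[lebesgue_tuple M]_t (F t * (sparsity_density tau%:num t)%:E).
Proof.
move=> mF F0; apply: ge0_integral_density => //.
- exact: measurable_sparsity_density.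
- by move=> t; exact: sparsity_density_ge0.
Qed.

Lemma sparsity_density_cons M (x : R) (t : M.-tuple R) :
  sparsity_density tau%:num (tuple_of_pair (x, t)) =
  (pdf x * sparsity_density tau%:num t)%R.
Proof.
rewrite /sparsity_density big_ord_recl; congr (_ * _)%R.
by apply: eq_bigr => j _; rewrite /tuple_of_pair/= tnthS.
Qed.

Lemma ge0_integral_sparsity_prior0 (F : 0.-tuple R -> \bar R) :
  measurable_fun setT F -> (forall t, 0 <= F t) ->
  \int[sparsity_prior 0 tau]_t F t = F [tuple].
Proof.
move=> mF F0; rewrite ge0_integral_sparsity_prior//=.
rewrite integral_dirac//; last first.
  by apply: emeasurable_funM => //; apply/measurable_EFinP;
    exact: measurable_sparsity_density.
by rewrite diracT mul1e /sparsity_density big_ord0 mule1.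
Qed.

(** Tonelli peels off the first coordinate, which opens the product prior to induction on [M]. *)
Lemma ge0_integral_sparsity_priorS M (F : M.+1.-tuple R -> \bar R) :
  measurable_fun setT F -> (forall t, 0 <= F t) ->
  \int[sparsity_prior M.+1 tau]_t F t =
  \int[mu]_x ((pdf x)%:E * \int[sparsity_prior M tau]_t F (tuple_of_pair (x, t))).
Proof.
move=> mF F0; rewrite ge0_integral_sparsity_prior//.
have mp := @measurable_tuple_of_pair R M.
pose G t := F t * (sparsity_density tau%:num t)%:E.
have mG : measurable_fun setT G.
  by apply: emeasurable_funM => //; apply/measurable_EFinP;
    exact: measurable_sparsity_density.
have G0 t : 0 <= G t by rewrite mule_ge0// lee_fin sparsity_density_ge0.
transitivity (\int[mu \x lebesgue_tuple M]_z (G \o @tuple_of_pair R M) z).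
  have := @ge0_integral_pushforward _ _ _ _ R _ mp (mu \x lebesgue_tuple M)
    setT G measurableT mG (fun x _ => G0 x).
  by rewrite preimage_setT.
rewrite fubini_tonelli1//; [|exact: (measurableT_comp mG mp)|by move=> z; exact: G0].
apply: eq_integral => x _; rewrite /fubini_F/=.
have mFx : measurable_fun setT (fun t : M.-tuple R => F (tuple_of_pair (x, t))).
  apply: measurableT_comp => //.
  by apply: (measurableT_comp mp); exact: measurable_pair1.
rewrite ge0_integral_sparsity_prior// -ge0_integralZl//.
- by apply: eq_integral => t _; rewrite /G sparsity_density_cons EFinM muleCA.
- by apply: emeasurable_funM => //; apply/measurable_EFinP;
    exact: measurable_sparsity_density.
- by move=> t _; rewrite mule_ge0// lee_fin sparsity_density_ge0.
- by rewrite lee_fin prior_pdf_ge0.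
Qed.

(** The coordinates are centred, uncorrelated and of variance [tau ^+ 2]. The offset [b] carries the
    induction: once the first coordinate is fixed at [x], it becomes [b + c ord0 * x]. *)
Lemma integral_sparsity_prior_sqr M (b : R) (c : 'I_M -> R) :
  \int[sparsity_prior M tau]_t
    ((b + \sum_(j < M) c j * tnth t j) ^+ 2)%:E =
  (b ^+ 2 + tau%:num ^+ 2 * \sum_(j < M) c j ^+ 2)%:E.
Proof.
elim: M b c => [|M IHM] b c.
  rewrite ge0_integral_sparsity_prior0.
  - by rewrite !big_ord0 mulr0 !addr0.
  - by apply/measurable_EFinP; under eq_fun do rewrite big_ord0; exact: measurable_cst.
  - by move=> t; rewrite lee_fin sqr_ge0.
rewrite ge0_integral_sparsity_priorS//; last 2 first.
- apply/measurable_EFinP/measurable_funX/measurable_funD => //.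
  apply: measurable_sum => j; apply: measurable_funM => //.
  exact: measurable_tnth.
- by move=> t; rewrite lee_fin sqr_ge0.
set S := (\sum_(j < M) c (lift ord0 j) ^+ 2)%R.
transitivity (\int[mu]_x (((b + c ord0 * x) ^+ 2 * pdf x)%:E +
    (tau%:num ^+ 2 * S)%:E * (pdf x)%:E)).
  apply: eq_integral => x _.
  rewrite (eq_integral (fun t : M.-tuple R => ((b + c ord0 * x +
      \sum_(j < M) c (lift ord0 j) * tnth t j) ^+ 2)%:E)); last first.
    move=> t _; rewrite big_ord_recl addrA; congr ((_ + _ + _) ^+ 2)%:E.
    by apply: eq_bigr => j _; rewrite /tuple_of_pair tnthS.
  by rewrite (IHM _ (fun j => c (lift ord0 j))) -!EFinM -EFinD; congr (_%:E); rewrite /S; ring.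
have mpdf := measurable_prior_pdf tau%:num.
have pdf0 x : (0 <= pdf x)%R by exact: prior_pdf_ge0.
have S0 : (0 <= tau%:num ^+ 2 * S)%R.
  by rewrite mulr_ge0// ?sqr_ge0// sumr_ge0// => j _; rewrite sqr_ge0.
rewrite ge0_integralD//.
- rewrite integral_sqr_prior_pdf// ge0_integralZl//.
  + rewrite integral_prior_pdf// mule1 -EFinD big_ord_recl; congr (_%:E).
    by rewrite /S; ring.
  + exact/measurable_EFinP.
  + by move=> x _; rewrite lee_fin.
- by move=> x _; rewrite lee_fin mulr_ge0 ?sqr_ge0.
- apply/measurable_EFinP/measurable_funM => //; apply/measurable_funX.
  by apply: measurable_funD => //; exact: measurable_funM.
- by move=> x _; rewrite mule_ge0// lee_fin.
- by apply: emeasurable_funM => //; exact/measurable_EFinP.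
Qed.

Lemma sparsity_prior_setT M : sparsity_prior M tau setT = 1.
Proof.
(* The second moment formula with constant integrand 1 computes the total mass. *)
have := integral_sparsity_prior_sqr 1%R (fun _ : 'I_M => 0%R).
rewrite (eq_integral (cst 1)); last first.
  move=> t _; rewrite big1 ?addr0 ?expr1n// => j _.
  by rewrite mul0r.
rewrite integral_cst// mul1e => ->; rewrite big1 ?mulr0 ?addr0 ?expr1n// => j _.
by rewrite expr0n.
Qed.

Definition tuple_add M (s t : M.-tuple R) : M.-tuple R :=
  [tuple (tnth s j + tnth t j)%R | j < M].

Lemma measurable_tuple_add M (s : M.-tuple R) : measurable_fun setT (tuple_add s).
Proof.
apply/measurable_fun_tnthP => i.
rewrite (_ : _ \o _ = fun t => (tnth s i + tnth t i)%R); last first.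
  by apply/funext => t; rewrite /= /tuple_add tnth_mktuple.
by apply: measurable_funD => //; exact: measurable_tnth.
Qed.

Lemma tuple_add_cons M (s : M.+1.-tuple R) (x : R) (t : M.-tuple R) :
  tuple_add s (tuple_of_pair (x, t)) =
  tuple_of_pair ((thead s + x)%R, tuple_add [tuple of behead s] t).
Proof.
apply: eq_from_tnth => i; rewrite tnth_mktuple /tuple_of_pair/=.
have [j ->|->//] := unliftP ord0 i.
by rewrite !tnthS tnth_mktuple {1}(tuple_eta s) tnthS.
Qed.

HB.instance Definition _ M := Measure_isProbability.Build _ _ R
  (sparsity_prior M tau) (sparsity_prior_setT M).

(** Induction on the coordinates: each one pays the factor of [prior_pdf_shift], after which the
    translation is absorbed by the invariance of Lebesgue measure. *)
Lemma sparsity_prior_shift M (s : M.-tuple R) (F : M.-tuple R -> \bar R) :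
  measurable_fun setT F -> (forall t, 0 <= F t) ->
  \int[sparsity_prior M tau]_t F (tuple_add s t) <=
  (\prod_(j < M) (1 + `|tnth s j| / tau%:num) ^+ 4)%:E *
    \int[sparsity_prior M tau]_t F t.
Proof.
elim: M s F => [|M IHM] s F mF F0.
  rewrite !ge0_integral_sparsity_prior0// ?big_ord0 ?mul1e//.
    by rewrite (tuple0 (tuple_add _ _)).
  by apply: (measurableT_comp mF); exact: measurable_tuple_add.
have mFs : measurable_fun setT (fun t => F (tuple_add s t)).
  by apply: (measurableT_comp mF); exact: measurable_tuple_add.
have mp := @measurable_tuple_of_pair R M.
rewrite !ge0_integral_sparsity_priorS//.
pose H x := \int[sparsity_prior M tau]_t F (tuple_of_pair (x, t)).
have mH : measurable_fun setT H.
  exact: (measurable_fun_fubini_tonelli_F (F \o @tuple_of_pair R M)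
    (measurableT_comp mF mp) (fun x => F0 _)).
have H0 x : 0 <= H x by exact: integral_ge0.
have mpdf := measurable_prior_pdf tau%:num.
have pdf0 x : (0 <= pdf x)%R by exact: prior_pdf_ge0.
set C' := (\prod_(j < M) (1 + `|tnth [tuple of behead s] j| / tau%:num) ^+ 4)%R.
have C0 (y : R) : (0 <= (1 + `|y| / tau%:num) ^+ 4)%R.
  by rewrite exprn_ge0// addr_ge0// divr_ge0.
have C'0 : (0 <= C')%R by apply: prodr_ge0 => j _.
set c := ((1 + `|thead s| / tau%:num) ^+ 4)%R.
have -> : (\prod_(j < M.+1) (1 + `|tnth s j| / tau%:num) ^+ 4 = c * C')%R.
  rewrite big_ord_recl; congr (_ * _)%R.
  by apply: eq_bigr => j _; rewrite {1}(tuple_eta s) tnthS.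
pose K x := (pdf x)%:E * H x.
have mK : measurable_fun setT K.
  by apply: emeasurable_funM => //; exact/measurable_EFinP.
have K0 x : 0 <= K x by rewrite mule_ge0// lee_fin.
have mKs : measurable_fun setT (fun x => K (thead s + x)%R).
  by apply: (measurableT_comp mK); exact: measurable_funD.
(* Both the density and the inner integral are now evaluated at [thead s + x], so the bound is the
   integral of a translate of [K]. *)
apply: (@le_trans _ _ (\int[mu]_x ((c * C')%:E * K (thead s + x)%R))).
  apply: ge0_le_integral => //.
  - by move=> x _; rewrite mule_ge0// ?lee_fin// integral_ge0.
  - apply: emeasurable_funM; first exact/measurable_EFinP.
    exact: (measurable_fun_fubini_tonelli_F
      ((fun t => F (tuple_add s t)) \o @tuple_of_pair R M)
      (measurableT_comp mFs mp) (fun x => F0 _)).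
  - exact: emeasurable_funM.
  - move=> x _; rewrite /K muleA -EFinM.
    apply: (@le_trans _ _ ((pdf x)%:E * (C'%:E * H (thead s + x)%R))).
      rewrite lee_wpmul2l ?lee_fin//.
      under eq_integral do rewrite tuple_add_cons.
      apply: (IHM _ (fun t => F (tuple_of_pair ((thead s + x)%R, t)))) => //.
      by apply: (measurableT_comp mF); apply: (measurableT_comp mp); exact: measurable_pair1.
    rewrite muleA -EFinM lee_wpmul2r ?H0// lee_fin.
    rewrite (mulrAC c) ler_wpM2r//; exact: prior_pdf_shift.
rewrite ge0_integralZl//; last by rewrite lee_fin mulr_ge0// /c C0.
by rewrite ge0_integral_shift.
Qed.

End prior_tuple.

(** * Stein's inequality for monotone functions *)

Section stein.
Context {R : realType} (sigma : R).
Hypothesis sigma_gt0 : 0 < sigma.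
Local Notation mu := (@lebesgue_measure R).
Local Notation gam := (normal_pdf 0 sigma).

Let sigma_neq0 : sigma != 0. Proof. by rewrite gt_eqF. Qed.

Lemma ge0_integral_normal_prob (F : R -> \bar R) :
  measurable_fun setT F -> (forall t, 0 <= F t)%E ->
  (\int[normal_prob 0 sigma]_t F t = \int[mu]_t (F t * (gam t)%:E))%E.
Proof.
move=> mF F0; apply: (@ge0_integral_density _ (measurableTypeR R)) => //.
- exact: measurable_normal_pdf.
- by move=> t; exact: normal_pdf_ge0.
Qed.

Lemma is_derive_normal_pdf (x : R) :
  is_derive x 1 gam (- (x / sigma ^+ 2) * gam x).
Proof.
rewrite normal_pdfE//= /normal_fun.
apply: is_derive_eq.
rewrite /GRing.scale/=.
by field.
Qed.

Variables (m dm : R -> R).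
Hypothesis m_deriv : forall x : R, is_derive x 1 m (dm x).
Hypothesis dm_ge0 : forall x, 0 <= dm x.
Hypothesis dm_cont : continuous dm.

Let m_cont : continuous m.
Proof.
move=> x; have [dx _] := m_deriv x.
exact/differentiable_continuous/derivable1_diffP.
Qed.

Lemma derive_ge0_ndecr (x y : R) : x <= y -> m x <= m y.
Proof.
move=> xy; apply: (@ger0_derive1_ndecr _ _ x y) => //.
- by move=> z _; rewrite derive1E (derive_val (is_derive := m_deriv z)).
- exact: continuous_subspaceT.
Qed.

Let h1 (u : R) : R := u * (m u - m 0) * gam u.
Let h2 (u : R) : R := sigma ^+ 2 * dm u * gam u.

Let incr_ge0 (u : R) : 0 <= u * (m u - m 0).
Proof.
have [u0|/ltW u0] := leP 0 u.
  by rewrite mulr_ge0// subr_ge0 derive_ge0_ndecr.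
by rewrite mulr_le0// subr_le0 derive_ge0_ndecr.
Qed.

Let h1_ge0 u : 0 <= h1 u.
Proof. by rewrite mulr_ge0 ?normal_pdf_ge0. Qed.

Let h2_ge0 u : 0 <= h2 u.
Proof. by rewrite mulr_ge0 ?normal_pdf_ge0// mulr_ge0// sqr_ge0. Qed.

Let h1_cont : continuous h1.
Proof.
move=> x; apply: cvgM; last exact: continuous_normal_pdf.
by apply: cvgM => //; apply: cvgB; [exact: m_cont|exact: cvg_cst].
Qed.

Let h2_cont : continuous h2.
Proof.
move=> x; apply: cvgM; last exact: continuous_normal_pdf.
by apply: cvgM; [exact: cvg_cst|exact: dm_cont].
Qed.

(* Integrating the derivative of [gam * (m - m 0)], the boundary terms are
   nonnegative because [m] is nondecreasing; no integrability is needed. *)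
Let stein_itv (A : R) : 0 < A ->
  (\int[mu]_(u in `[(- A)%R, A]) (h1 u)%:E <= \int[mu]_(u in `[(- A)%R, A]) (h2 u)%:E)%E.
Proof.
move=> A0; have AA : - A < A by rewrite gtrN.
(* The factor [sigma ^+ 2] clears the denominator in the derivative [- (u / sigma ^+ 2) * gam u] of
   [gam], so that [F] has derivative [h2 - h1]. *)
pose F u := sigma ^+ 2 * ((m u - m 0) * gam u).
have dF (u : R) : is_derive u 1 F (h2 u - h1 u).
  have dg := is_derive_normal_pdf u.
  have dmu := m_deriv u.
  rewrite /F; apply: is_derive_eq.
  rewrite /h2 /h1 /GRing.scale/=; by field.
have F_cont : continuous F.
  move=> x; have [dx _] := dF x.
  exact/differentiable_continuous/derivable1_diffP.
have hcont : continuous (h2 \- h1)%R.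
  by move=> x; apply: cvgB; [exact: h2_cont|exact: h1_cont].
have FA : (\int[mu]_(u in `[(- A)%R, A]) ((h2 \- h1) u)%:E = (F A)%:E - (F (- A)%R)%:E)%E.
  apply: continuous_FTC2 => //.
  - exact: continuous_subspaceT.
  - split.
    + by move=> x _; have [] := dF x.
    + by apply: cvg_at_right_filter; exact: F_cont.
    + by apply: cvg_at_left_filter; exact: F_cont.
  - by move=> x _; rewrite derive1E; have [_ ->] := dF x.
have int h : continuous h -> mu.-integrable `[- A, A] (EFin \o h).
  move=> hc; apply: continuous_compact_integrable; first exact: segment_compact.
  exact: continuous_subspaceT.
have -> : (\int[mu]_(u in `[(- A)%R, A]) (h2 u)%:E =
   \int[mu]_(u in `[(- A)%R, A]) (h1 u)%:E +
   \int[mu]_(u in `[(- A)%R, A]) ((h2 \- h1) u)%:E)%E.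
  rewrite -integralD_EFin//; [|exact: int..].
  by apply: eq_integral => u _ /=; congr (_%:E); rewrite addrC subrK.
rewrite FA leeDl// -EFinB lee_fin subr_ge0 /F ler_pM2l ?exprn_gt0//.
apply: (@le_trans _ _ 0).
  rewrite mulr_le0_ge0 ?normal_pdf_ge0// subr_le0 derive_ge0_ndecr//.
  by rewrite oppr_le0 ltW.
by rewrite mulr_ge0 ?normal_pdf_ge0// subr_ge0 derive_ge0_ndecr// ltW.
Qed.

(** Centring [m] at [m 0] makes the left integrand nonnegative, so [stein_itv] passes to the whole
    line by exhaustion. *)
Lemma stein_le :
  (\int[normal_prob 0 sigma]_u (u * (m u - m 0))%:E <=
   \int[normal_prob 0 sigma]_u (sigma ^+ 2 * dm u)%:E)%E.
Proof.
have mh1 : measurable_fun setT h1 by exact: continuous_measurable_fun.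
have mh2 : measurable_fun setT h2 by exact: continuous_measurable_fun.
have mf2 : measurable_fun setT (fun u => (sigma ^+ 2 * dm u)%:E).
  by apply/measurable_EFinP/measurable_funM => //; exact: continuous_measurable_fun.
have mf1 : measurable_fun setT (fun u : R => (u * (m u - m 0))%:E).
  apply/measurable_EFinP/measurable_funM => //.
  by apply: measurable_funB => //; exact: continuous_measurable_fun.
have f2_ge0 u : (0 <= (sigma ^+ 2 * dm u)%:E)%E.
  by rewrite lee_fin mulr_ge0// sqr_ge0.
have f1_ge0 (u : R) : (0 <= (u * (m u - m 0))%:E)%E by rewrite lee_fin.
rewrite !ge0_integral_normal_prob//.
(* The successor keeps the half-length positive, as [stein_itv] requires. *)
pose I (n : nat) : set R := `[- n.+1%:R, n.+1%:R]%classic.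
have IT : \bigcup_n I n = setT.
  apply/seteqP; split => // x _; exists (Num.truncn `|x|) => //=.
  rewrite /I/= in_itv/= -ler_norml ltW//.
  by have := truncnS_gt `|x|.
have mI n : measurable (I n) by exact: measurable_itv.
have ndI : nondecreasing_seq I.
  move=> n k nk; apply/subsetPset => x; rewrite /I/= !in_itv/= -!ler_norml.
  by move=> /le_trans; apply; rewrite ler_nat.
have cvgI : (\int[mu]_(u in I n) (h1 u)%:E @[n --> \oo] --> \int[mu]_u (h1 u)%:E)%E.
  rewrite -IT; apply: ge0_nondecreasing_set_cvg_integral => //.
  - by move=> n; apply/measurable_EFinP/measurable_funTS.
  - by move=> n x _; rewrite lee_fin.
rewrite -(cvg_lim _ cvgI)//; apply: lime_le.
  by apply/cvg_ex; eexists; exact: cvgI.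
apply: nearW => n; apply: (le_trans (stein_itv _)); first by rewrite ltr0Sn.
apply: ge0_subset_integral => //.
- exact/measurable_EFinP.
- by move=> x _; rewrite lee_fin h2_ge0.
Qed.

End stein.

(** * Posterior mean and variance as functions of one observation *)

Lemma Rintegral_sum d (L : measurableType d) (R : realType)
    (mu : {measure set L -> \bar R}) (I : Type) (s : seq I) (F : I -> L -> R) :
  (forall i, mu.-integrable setT (EFin \o F i)) ->
  \int[mu]_l (\sum_(i <- s) F i l) = \sum_(i <- s) \int[mu]_l F i l.
Proof.
move=> iF; elim: s => [|i s IHs].
  under eq_Rintegral do rewrite big_nil.
  by rewrite Rintegral_cst// mul0r big_nil.
under eq_Rintegral do rewrite big_cons.
rewrite RintegralD//; first by rewrite IHs big_cons.
rewrite (_ : _ \o _ = fun l => (\sum_(i <- s) (F i l)%:E)%E); last first.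
  by apply/funext => l; rewrite /= sumEFin.
by apply: integrable_sum => // i' _; exact: iF.
Qed.

Section probability_integrals.
Context d (L : measurableType d) (R : realType) (mu : probability L R).

Lemma bounded_integrable (h : L -> R) (K : R) : measurable_fun setT h ->
  (forall l, `|h l| <= K) -> mu.-integrable setT (EFin \o h).
Proof.
move=> mh hK; apply: measurable_bounded_integrable => //.
  exact: (le_lt_trans (probability_le1 mu measurableT) (ltry _)).
exists K; split; [exact: num_real|move=> x Kx l _].
exact: le_trans (hK l) (ltW Kx).
Qed.

(** A zero integral would make [h] vanish almost everywhere, so the whole space would be a null set,
    against total mass 1. *)
Lemma Rintegral_gt0 (h : L -> R) : mu.-integrable setT (EFin \o h) ->
  (forall l, 0 < h l) -> 0 < \int[mu]_l h l.
Proof.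
move=> ih h0; rewrite lt_neqAle Rintegral_ge0 ?andbT; last first.
  by move=> l _; exact: ltW.
apply/eqP => /esym ih0.
have mh : measurable_fun setT (EFin \o h) by case/integrableP : ih.
have : (\int[mu]_l `|(EFin \o h) l| = 0)%E.
  rewrite (eq_integral (EFin \o h)); last first.
    by move=> l _ /=; rewrite gtr0_norm.
  have := integrable_fin_num measurableT ih.
  by move=> /fineK <-; congr (_%:E).
move/(ae_eq_integral_abs _ measurableT mh).
move=> [N [mN N0 hN]].
have : N = setT.
  apply/seteqP; split => // l _; apply: hN => /= /(_ Logic.I) [].
  by move=> hl; have := h0 l; rewrite hl ltxx.
move=> NT; have := @probability_setT _ _ _ mu; rewrite -NT.
have -> : mu N = 0%E by exact: N0.
by move=> /eqP; rewrite eqe eq_sym oner_eq0.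
Qed.

End probability_integrals.

Section gaussian_weights.
Context d (L : measurableType d) (R : realType) (mu : probability L R).
Variables (beta : R) (a w : L -> R).
Hypothesis beta_gt0 : 0 < beta.
Hypotheses (ma : measurable_fun setT a) (mw : measurable_fun setT w).
Hypothesis w_gt0 : forall l, 0 < w l.
Hypothesis w_le1 : forall l, w l <= 1.

Definition gkern (t u : R) : R := expR (- (t - u) ^+ 2 / beta).

Lemma gkern_ge0 t u : 0 <= gkern t u.
Proof. exact: expR_ge0. Qed.

(** Since [|u|^k <= exp (k |u|)], it is enough to compare exponents, and their difference is a sum
    of squares over [beta]. The bound does not depend on [u], so every moment of the weighted prior
    is finite. *)
Lemma gkern_bound (k : nat) (t u : R) :
  `|u| ^+ k * gkern t u <= expR (t ^+ 2 / beta + k%:R ^+ 2 * beta / 2).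
Proof.
have uk : `|u| ^+ k <= expR (k%:R * `|u|).
  rewrite expRM_natl lerXn2r ?nnegrE ?expR_ge0//.
  by rewrite (le_trans _ (expR_ge1Dx _))// lerDr.
apply: (le_trans (ler_wpM2r (gkern_ge0 _ _) uk)).
rewrite /gkern -expRD ler_expR -subr_ge0.
have b0 : beta != 0 by rewrite gt_eqF.
have -> : t ^+ 2 / beta + k%:R ^+ 2 * beta / 2 - (k%:R * `|u| + - (t - u) ^+ 2 / beta)
  = ((2 * t - u) ^+ 2 / 2 + (`|u| - k%:R * beta) ^+ 2 / 2) / beta.
  by rewrite (sqrrB `|u|) real_normK ?num_real//; field.
by rewrite divr_ge0 ?(ltW beta_gt0)// addr_ge0// divr_ge0// sqr_ge0.
Qed.

Lemma measurable_gkern t : measurable_fun setT (gkern t).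
Proof.
apply: measurableT_comp => //; apply: measurable_funM => //.
apply: measurableT_comp => //; apply: measurable_funX.
exact: measurable_funB.
Qed.

(** The unnormalised [k]-th posterior moment of [a] given the observation [t]; [gmom 0] is the
    normalising constant. *)
Definition gmom (k : nat) (t : R) : R := \int[mu]_l (w l * a l ^+ k * gkern t (a l)).

Lemma measurable_gmom (k : nat) (t : R) :
  measurable_fun setT (fun l => w l * a l ^+ k * gkern t (a l)).
Proof.
apply: measurable_funM; first by apply: measurable_funM => //; exact: measurable_funX.
exact: (measurableT_comp (measurable_gkern t)).
Qed.

Lemma gmom_bound k t l : `|w l * a l ^+ k * gkern t (a l)| <=
  expR (t ^+ 2 / beta + k%:R ^+ 2 * beta / 2).
Proof.
rewrite !normrM (ger0_norm (gkern_ge0 _ _)) (gtr0_norm (w_gt0 _)) normrX.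
rewrite -mulrA (le_trans _ (gkern_bound k t (a l)))//.
by rewrite ler_piMl// mulr_ge0 ?exprn_ge0// gkern_ge0.
Qed.

Lemma integrable_gmom k t :
  mu.-integrable setT (EFin \o (fun l => w l * a l ^+ k * gkern t (a l))).
Proof. exact: bounded_integrable (measurable_gmom k t) (gmom_bound k t). Qed.

Lemma is_derive_gkern (c t u : R) :
  is_derive t 1 (fun t => c * gkern t u) (c * gkern t u * (2 / beta * (u - t))).
Proof.
rewrite /gkern; apply: is_derive_eq.
rewrite /GRing.scale/=; field.
by rewrite gt_eqF.
Qed.

(* The domination on [t - 1, t + 1] is uniform in [a], as Gaussian kernels
   absorb powers of [a] (gkern_bound). *)
Lemma is_derive_gmom (k : nat) (t : R) :
  is_derive t 1 (gmom k) (2 / beta * (gmom k.+1 t - t * gmom k t)).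
Proof.
pose f (s : R) (l : L) := w l * a l ^+ k * gkern s (a l).
have It : `]t - 1, t + 1[%classic t by rewrite /= in_itv/= ltrBlDr ltrDl andbb ltr01.
have derf (s : R) (l : L) : is_derive s 1 (f ^~ l) (f s l * (2 / beta * (a l - s))).
  exact: is_derive_gkern.
have d1f (s : R) (l : L) : partial1of2 f s l = f s l * (2 / beta * (a l - s)).
  by rewrite partial1of2E; have [_ ->] := derf s l.
(* [B] bounds [s ^+ 2] on the interval, and [K] bounds the derivative through its two moments, of
   orders [k.+1] and [k], separated in [splitf]. *)
pose B := (`|t| + 1) ^+ 2.
pose K := 2 / beta * (expR (B / beta + k.+1%:R ^+ 2 * beta / 2) +
  (`|t| + 1) * expR (B / beta + k%:R ^+ 2 * beta / 2)).
have K_ge0 : 0 <= K.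
  by rewrite mulr_ge0 ?divr_ge0 ?(ltW beta_gt0)// addr_ge0 ?expR_ge0//
    mulr_ge0 ?expR_ge0// addr_ge0.
have splitf (s : R) (l : L) : f s l * (2 / beta * (a l - s)) =
    2 / beta * (w l * a l ^+ k.+1 * gkern s (a l) - s * f s l).
  by rewrite /f exprSr; ring.
have G_ub (s : R) (l : L) : `]t - 1, t + 1[%classic s -> [set: L] l ->
    `|partial1of2 f s l| <= cst K l.
  move=> /=; rewrite in_itv/= => /andP[s1 s2] _.
  have st : `|s| <= `|t| + 1.
    rewrite -(subrK t s) addrC (le_trans (ler_normD _ _))// lerD2l.
    by rewrite ler_norml; apply/andP; split; lra.
  have sB : s ^+ 2 / beta <= B / beta.
    by rewrite ler_pM2r ?invr_gt0// -(real_normK (num_real s)) lerXn2r ?nnegrE// addr_ge0.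
  rewrite d1f splitf normrM ger0_norm ?divr_ge0 ?(ltW beta_gt0)//.
  rewrite ler_wpM2l ?divr_ge0 ?(ltW beta_gt0)//.
  rewrite (le_trans (ler_normB _ _))// lerD//.
    by rewrite (le_trans (gmom_bound _ _ _))// ler_expR lerD2r.
  rewrite normrM ler_pM//.
  by rewrite (le_trans (gmom_bound _ _ _))// ler_expR lerD2r.
have intf (s : R) : `]t - 1, t + 1[%classic s -> mu.-integrable setT (EFin \o f s).
  by move=> _; exact: integrable_gmom.
have derf1 (s : R) (l : L) : `]t - 1, t + 1[%classic s -> [set: L] l -> derivable (f ^~ l) s 1.
  by move=> _ _; have [] := derf s l.
have intG : mu.-integrable setT (EFin \o cst K).
  by apply: (@bounded_integrable _ _ _ mu _ K) => // l; rewrite ger0_norm.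
apply: DeriveDef.
  exact: (derivable_under_integral measurableT It intf derf1 (fun=> K_ge0) intG G_ub).
rewrite -derive1E.
rewrite (differentiation_under_integral measurableT It intf derf1 (fun=> K_ge0) intG G_ub).
under eq_Rintegral do rewrite d1f splitf.
have ints : mu.-integrable setT (EFin \o (fun l => t * f t l)).
  by have := integrableZl measurableT t (integrable_gmom k t).
rewrite RintegralZl//.
  rewrite RintegralB//; last exact: integrable_gmom.
  by rewrite RintegralZl//; exact: integrable_gmom.
by have := integrableB measurableT (integrable_gmom k.+1 t) ints.
Qed.

Lemma gmom0_gt0 t : 0 < gmom 0 t.
Proof.
apply: Rintegral_gt0; first exact: integrable_gmom.
by move=> l; rewrite expr0 mulr1 mulr_gt0// expR_gt0.
Qed.

Definition gmean t := gmom 1 t / gmom 0 t.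
Definition gvar t := gmom 2 t / gmom 0 t - gmean t ^+ 2.

(** In the quotient rule the two terms [t * gmom k t] coming from [is_derive_gmom] cancel, and what
    remains is the variance. *)
Lemma is_derive_gmean (t : R) : is_derive t 1 gmean (2 / beta * gvar t).
Proof.
have g0 : gmom 0 t != 0 by rewrite gt_eqF// gmom0_gt0.
have dV := is_deriveV g0 (is_derive_gmom 0 t).
have d1 := is_derive_gmom 1 t.
apply: is_derive_eq.
rewrite /GRing.scale/= /gvar /gmean; field.
by rewrite g0 gt_eqF.
Qed.

Lemma continuous_gvar : continuous gvar.
Proof.
have cG k : continuous (gmom k).
  move=> x; have [dx _] := is_derive_gmom k x.
  exact/differentiable_continuous/derivable1_diffP.
move=> t; have g0 : gmom 0 t != 0 by rewrite gt_eqF// gmom0_gt0.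
apply: cvgB.
  by apply: cvgM; [exact: cG|apply: cvgV => //; exact: cG].
apply: (@continuous_comp _ _ _ gmean (fun x => x ^+ 2)).
  by apply: cvgM; [exact: cG|apply: cvgV => //; exact: cG].
exact: exprn_continuous.
Qed.

(** Used at the posterior mean, to see that [gvar] is nonnegative, and at the observation, for the
    mean squared residual. *)
Lemma gmom_sqr (c t : R) :
  \int[mu]_l (w l * (a l - c) ^+ 2 * gkern t (a l)) =
  gmom 2 t - c *+ 2 * gmom 1 t + c ^+ 2 * gmom 0 t.
Proof.
pose f k l := w l * a l ^+ k * gkern t (a l).
transitivity (\int[mu]_l (f 2 l - c *+ 2 * f 1 l + c ^+ 2 * f 0 l)).
  by apply: eq_Rintegral => l _; rewrite /f; ring.
have i2 := integrable_gmom 2 t.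
have i1 : mu.-integrable setT (EFin \o (fun l => c *+ 2 * f 1 l)).
  by have := integrableZl measurableT (c *+ 2) (integrable_gmom 1 t).
have i0 : mu.-integrable setT (EFin \o (fun l => c ^+ 2 * f 0 l)).
  by have := integrableZl measurableT (c ^+ 2) (integrable_gmom 0 t).
have i21 : mu.-integrable setT (EFin \o (fun l => f 2 l - c *+ 2 * f 1 l)).
  by have := integrableB measurableT i2 i1.
rewrite RintegralD// RintegralB// !RintegralZl//; exact: integrable_gmom.
Qed.

Lemma gvarE t : gvar t =
  (\int[mu]_l (w l * (a l - gmean t) ^+ 2 * gkern t (a l))) / gmom 0 t.
Proof.
have g0 : gmom 0 t != 0 by rewrite gt_eqF// gmom0_gt0.
by rewrite gmom_sqr /gvar /gmean; field.
Qed.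

Lemma gvar_ge0 t : 0 <= gvar t.
Proof.
rewrite gvarE divr_ge0 ?(ltW (gmom0_gt0 _))//.
apply: Rintegral_ge0 => l _.
by rewrite mulr_ge0 ?gkern_ge0// mulr_ge0 ?sqr_ge0// ltW.
Qed.

(** Stein's inequality for [u |-> 2 * gmean (b + u)], whose derivative is [4 / beta * gvar (b + u)].
    The temperature condition makes the resulting factor [4 * sigma ^+ 2 / beta] at most 1. *)
Lemma stein_gmean (sigma b : R) : 0 < sigma -> 4 * sigma ^+ 2 <= beta ->
  (\int[normal_prob 0 sigma]_u (2 * u * (gmean (b + u) - gmean b))%:E <=
   \int[normal_prob 0 sigma]_u (gvar (b + u))%:E)%E.
Proof.
move=> s0 sb.
have cV : continuous (fun u => gvar (b + u)).
  move=> u; apply: (@continuous_comp _ _ _ (fun u => b + u) gvar).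
    by apply: cvgD; [exact: cvg_cst|exact: cvg_id].
  exact: continuous_gvar.
have dm (u : R) : is_derive u 1 (fun u => 2 * gmean (b + u))
    (4 / beta * gvar (b + u)).
  have d1 : is_derive u 1 (fun u => b + u) 1.
    by have := is_deriveD (is_derive_cst b u 1) (is_derive_id u 1); rewrite add0r.
  have d2 := @is_derive1_comp _ gmean (fun u => b + u) u _ _ (is_derive_gmean (b + u)) d1.
  apply: is_derive_eq; rewrite /GRing.scale/=.
  by field; rewrite gt_eqF.
have dm_ge0 (u : R) : 0 <= 4 / beta * gvar (b + u).
  by rewrite mulr_ge0 ?gvar_ge0// divr_ge0// ltW.
have dm_cont : continuous (fun u : R => 4 / beta * gvar (b + u)).
  by move=> u; apply: cvgM; [exact: cvg_cst|exact: cV].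
apply: (le_trans _ (le_trans (stein_le s0 dm dm_ge0 dm_cont) _)).
  rewrite le_eqVlt; apply/orP; left; apply/eqP; apply: eq_integral => u _.
  by rewrite addr0; congr (_%:E); ring.
apply: ge0_le_integral => //.
- by move=> u _; rewrite lee_fin mulr_ge0// sqr_ge0.
- apply/measurable_EFinP; apply: measurable_funM => //.
  exact: continuous_measurable_fun.
- by apply/measurable_EFinP; exact: continuous_measurable_fun.
- move=> u _; rewrite lee_fin mulrA ler_piMl ?gvar_ge0//.
  by rewrite mulrA ler_pdivrMr// mul1r mulrC.
Qed.

End gaussian_weights.

(** * Independence of one noise variable from the others *)

Section boxes.
Context {R : realType} (n : nat).

Definition box (B : 'I_n -> set R) : set (n.-tuple R) :=
  [set t | forall j, B j (tnth t j)].

Lemma measurable_box B : (forall j, measurable (B j)) -> measurable (box B).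
Proof.
move=> mB; rewrite (_ : box B = \bigcap_(j in [set: 'I_n])
    ((@tnth _ R ^~ j) @^-1` B j)); last first.
  by apply/seteqP; split => t /= h j; [move=> _; exact: h|exact: (h j Logic.I)].
apply: fin_bigcap_measurable => [|j _]; first exact: finite_finset.
by rewrite -[X in measurable X]setTI; exact: measurable_tnth.
Qed.

(** A pi-system generating the product sigma-algebra, on which finite measures can be compared. *)
Definition boxes : set (set (n.-tuple R)) :=
  [set box B | B in [set B | forall j, measurable (B j)]].

Lemma measurable_boxesE : @measurable _ (n.-tuple R) = <<s boxes >>.
Proof.
apply/seteqP; split; last first.
  apply: smallest_sub; first exact: sigma_algebra_measurable.
  by move=> _ [B mB <-]; exact: measurable_box.
apply: smallest_sub; first exact: smallest_sigma_algebra.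
rewrite -bigcup_seq => X [/= j _ [Y mY <-]]; apply: sub_sigma_algebra.
exists (fun k => if k == j then Y else setT).
  by move=> k /=; case: ifP.
apply/seteqP; split => t /=.
  by move=> h; split => //; have := h j; rewrite eqxx.
by move=> [_ h] k; case: eqP => // ->.
Qed.

Lemma setI_closed_boxes : setI_closed boxes.
Proof.
move=> _ _ [B mB <-] [C mC <-]; exists (fun j => B j `&` C j).
  by move=> j; exact: measurableI.
apply/seteqP; split => t /=; first by move=> h; split => j; have [] := h j.
by move=> [h1 h2] j.
Qed.

Lemma boxes_setT : boxes setT.
Proof. by exists (fun=> setT) => //; apply/seteqP; split. Qed.

End boxes.

Section joint_law.
Context d (T : measurableType d) (R : realType) (P : probability T R).
Context (n : nat) (xi : 'I_n -> {RV P >-> R}) (sigma : R).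
Hypothesis xi_ind : mutually_independent xi.
Hypothesis xi_gauss : forall i, centered_gaussian sigma (xi i).

(* The coordinate [i] is set to [0] rather than removed, so that all the
   [freeze i] have the same type. *)
Definition freeze (i : 'I_n) (w : T) : n.-tuple R :=
  [tuple if j == i then 0 else xi j w | j < n].

Lemma measurable_freeze i : measurable_fun setT (freeze i).
Proof.
apply/measurable_fun_tnthP => j.
rewrite (_ : _ \o _ = fun w => if j == i then 0 else xi j w); last first.
  by apply/funext => w; rewrite /= tnth_mktuple.
by case: (j == i); [exact: measurable_cst|exact: measurable_funP].
Qed.

Lemma independent_box (C : 'I_n -> set R) : (forall j, measurable (C j)) ->
  P [set w | forall j, C j (xi j w)] = (\prod_(j < n) P (xi j @^-1` C j))%E.
Proof.
move=> mC; have := xi_ind [set: 'I_n]%SET mC.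
rewrite (eq_bigl predT) => [|j]; last by rewrite inE.
move=> <-; congr (P _); apply/seteqP; split => w /= h j.
  by move=> _; exact: h.
by apply: (h j); rewrite /= inE.
Qed.

Lemma freeze_box (i : 'I_n) (A : set R) (B : 'I_n -> set R) :
  measurable A -> (forall j, measurable (B j)) ->
  P (xi i @^-1` A `&` freeze i @^-1` box B) =
  (normal_prob 0 sigma A * P (freeze i @^-1` box B))%E.
Proof.
move=> mA mB.
pose C (D : set R) j := if j == i then (if `[< B i 0 >] then D else set0) else B j.
have mC D : measurable D -> forall j, measurable (C D j).
  by move=> mD j; rewrite /C; case: ifP => // _; case: ifP.
have E D : xi i @^-1` D `&` freeze i @^-1` box B = [set w | forall j, C D j (xi j w)].
  apply/seteqP; split => w /=.
    move=> [Dw h] j; rewrite /C; have := h j; rewrite tnth_mktuple.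
    by case: eqP => // -> B0; rewrite asboolT.
  move=> h; have := h i; rewrite /C eqxx; case: asboolP => // B0 Dw; split => // j.
  rewrite tnth_mktuple; have := h j; rewrite /C.
  by case: eqP => // ->.
rewrite E; have := E setT; rewrite preimage_setT setTI => ->.
rewrite !independent_box//; [|exact: mC..].
rewrite (bigD1 i)//= [in RHS](bigD1 i)//= /C eqxx.
rewrite (eq_bigr (fun j => P (xi j @^-1` B j))); last by move=> j /negbTE ->.
rewrite [in RHS](eq_bigr (fun j => P (xi j @^-1` B j))); last by move=> j /negbTE ->.
case: asboolP => _; last by rewrite preimage_set0 measure0 !mul0e mule0.
by rewrite preimage_setT probability_setT mul1e -(xi_gauss i mA).
Qed.

(** For fixed [A] both sides are finite measures in [B], which agree on boxes by [freeze_box]. *)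
Lemma freeze_independent (i : 'I_n) (A : set R) (B : set (n.-tuple R)) :
  measurable A -> measurable B ->
  P (xi i @^-1` A `&` freeze i @^-1` B) =
  (normal_prob 0 sigma A * P (freeze i @^-1` B))%E.
Proof.
move=> mA mB.
pose V : {mfun T >-> n.-tuple R} :=
  HB.pack (freeze i) (isMeasurableFun.Build _ _ _ _ _ (measurable_freeze i)).
have mxA : measurable (xi i @^-1` A).
  by rewrite -[X in measurable X]setTI; exact: measurable_funP.
have NA : normal_prob 0 sigma A \is a fin_num by exact: fin_num_measure.
pose r : {nonneg R} := NngNum (fine_ge0 (measure_ge0 (normal_prob 0 sigma) A)).
pose m1 := pushforward (mrestr P mxA) V.
pose m2 := mscale r (distribution P V).
have m1E D : m1 D = P (xi i @^-1` A `&` freeze i @^-1` D).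
  by rewrite setIC.
have m2E D : m2 D = (normal_prob 0 sigma A * P (freeze i @^-1` D))%E.
  by rewrite -[in RHS](fineK NA).
rewrite -m1E -m2E; apply: (measure_unique (@boxes R n) (fun=> setT)) => //.
- exact: measurable_boxesE.
- exact: setI_closed_boxes.
- by move=> _; exact: boxes_setT.
- by rewrite bigcup_const.
- move=> _ [C mC <-].
  exact: (etrans (m1E _) (etrans (freeze_box _ mA mC) (esym (m2E _)))).
- move=> _; suff : (m1 setT < +oo)%E by [].
  rewrite m1E preimage_setT setIT.
  exact: (le_lt_trans (probability_le1 P mxA) (ltry _)).
Qed.

(** By independence the joint law of [xi i] and [freeze i] is a product; Tonelli then integrates the
    [i]-th noise first, the others being fixed. *)
Lemma ge0_integral_freeze (i : 'I_n) (H : R * n.-tuple R -> \bar R) :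
  measurable_fun setT H -> (forall z, 0 <= H z)%E ->
  (\int[P]_w H (xi i w, freeze i w) =
   \int[P]_w \int[normal_prob 0 sigma]_u H (u, freeze i w))%E.
Proof.
move=> mH H0.
have mV := measurable_freeze i.
pose V : {mfun T >-> n.-tuple R} :=
  HB.pack (freeze i) (isMeasurableFun.Build _ _ _ _ _ mV).
have mW : measurable_fun setT
    (fun w => (xi i w, freeze i w) : (measurableTypeR R * n.-tuple R)%type).
  have mxi : measurable_fun setT (xi i) by exact: measurable_funP.
  by apply/measurable_fun_pairP; split; [exact: mxi|exact: mV].
pose W : {mfun T >-> (measurableTypeR R * n.-tuple R)%type} :=
  HB.pack (fun w => (xi i w, freeze i w)) (isMeasurableFun.Build _ _ _ _ _ mW).
pose N := normal_prob 0 sigma.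
transitivity (\int[distribution P W]_z H z)%E.
  by rewrite ge0_integral_distribution.
transitivity (\int[N \x distribution P V]_z H z)%E.
  apply: eq_measure_integral => X mX _; apply/esym.
  apply: product_measure_unique => // A B mA mB.
  by rewrite -freeze_independent.
rewrite fubini_tonelli2// ge0_integral_distribution//.
- exact: measurable_fun_fubini_tonelli_G.
- by move=> v; apply: integral_ge0 => u _; exact: H0.
Qed.

Lemma ge0_le_integral_freeze (i : 'I_n) (H1 H2 : R * n.-tuple R -> \bar R) :
  measurable_fun setT H1 -> (forall z, 0 <= H1 z)%E ->
  measurable_fun setT H2 -> (forall z, 0 <= H2 z)%E ->
  (forall v, \int[normal_prob 0 sigma]_u H1 (u, v) <=
             \int[normal_prob 0 sigma]_u H2 (u, v))%E ->
  (\int[P]_w H1 (xi i w, freeze i w) <= \int[P]_w H2 (xi i w, freeze i w))%E.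
Proof.
move=> mH1 H1_ge0 mH2 H2_ge0 H12; rewrite !ge0_integral_freeze//.
have mf := measurable_freeze i.
apply: ge0_le_integral => //.
- by move=> w _; exact: integral_ge0.
- exact: (measurableT_comp (measurable_fun_fubini_tonelli_G
    (m1 := normal_prob 0 sigma) H1 mH1 H1_ge0) mf).
- exact: (measurableT_comp (measurable_fun_fubini_tonelli_G
    (m1 := normal_prob 0 sigma) H2 mH2 H2_ge0) mf).
Qed.

End joint_law.

(** * The posterior *)

Section gmean_incr.
Context d (L : measurableType d) (R : realType) (mu : probability L R).
Variables (beta : R) (a w : L -> R).
Hypothesis beta_gt0 : 0 < beta.
Hypotheses (ma : measurable_fun setT a) (mw : measurable_fun setT w).
Hypothesis w_gt0 : forall l, 0 < w l.
Hypothesis w_le1 : forall l, w l <= 1.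

(** The posterior mean is nondecreasing in its observation, its derivative being a positive multiple
    of a variance. *)
Lemma gmean_incr (b u : R) :
  0 <= u * (gmean mu beta a w (b + u) - gmean mu beta a w b).
Proof.
have ndm := derive_ge0_ndecr (is_derive_gmean mu beta_gt0 ma mw w_gt0 w_le1)
  (fun x => mulr_ge0 (divr_ge0 (ler0n R 2) (ltW beta_gt0))
    (gvar_ge0 mu beta_gt0 ma mw w_gt0 w_le1 x)).
have [u0|/ltW u0] := leP 0 u.
  by rewrite mulr_ge0// subr_ge0 ndm// lerDl.
by rewrite mulr_le0// subr_le0 ndm// gerDl.
Qed.

End gmean_incr.

Section parametric.
Context d (L : measurableType d) (R : realType) (mu : probability L R).
Context d' (D : measurableType d').

(** Tonelli gives measurability for the positive and negative parts separately, and [Rintegral] is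
    the [fine] of their difference. *)
Lemma measurable_Rintegral_param (F : D * L -> R) : measurable_fun setT F ->
  measurable_fun setT (fun x => \int[mu]_l F (x, l)).
Proof.
move=> mF; have mEF : measurable_fun setT (EFin \o F) by exact/measurable_EFinP.
apply: (measurableT_comp (fine_measurable measurableT)).
rewrite (_ : (fun x => _) = (fun x => \int[mu]_l ((EFin \o F)^\+ (x, l)) -
    \int[mu]_l ((EFin \o F)^\- (x, l)))%E); last first.
  apply/funext => x; rewrite integralE; congr (_ - _)%E;
    by apply: eq_integral => l _; rewrite ?funeposE ?funenegE.
apply: emeasurable_funB.
- apply: (measurable_fun_fubini_tonelli_F (EFin \o F)^\+%E) => //.
  exact: measurable_funepos.
- apply: (measurable_fun_fubini_tonelli_F (EFin \o F)^\-%E) => //.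
  exact: measurable_funeneg.
Qed.

Lemma measurable_gkern_param (beta : R) (s u : D -> R) :
  measurable_fun setT s -> measurable_fun setT u ->
  measurable_fun setT (fun x => gkern beta (s x) (u x)).
Proof.
move=> ms mu'; apply: measurableT_comp => //; apply: measurable_funM => //.
apply: measurableT_comp => //; apply: measurable_funX.
exact: measurable_funB.
Qed.

End parametric.

Section posterior.
Context d (L : measurableType d) (R : realType) (mu : probability L R).
Context (n : nat) (g : 'I_n -> L -> R) (beta : R).
Hypothesis beta_gt0 : 0 < beta.
Hypothesis mg : forall i, measurable_fun setT (g i).

Definition sqdev (y : 'I_n -> R) (l : L) : R := \sum_(j < n) (y j - g j l) ^+ 2.

Definition gibbs_kern (y : 'I_n -> R) (l : L) : R := expR (- sqdev y l / beta).

Definition others (i : 'I_n) (y : 'I_n -> R) (l : L) : R :=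
  expR (- (\sum_(j < n | j != i) (y j - g j l) ^+ 2) / beta).

(* [gibbs_kern y] is [others i y] times the Gaussian kernel in [y i] only, which
   puts the posterior in the form of [gmean] and [gvar] for each [i]. *)
Definition post_mean i y := gmean mu beta (g i) (others i y) (y i).
Definition post_var i y := gvar mu beta (g i) (others i y) (y i).

Lemma gibbs_kernE i y l : gibbs_kern y l = others i y l * gkern beta (y i) (g i l).
Proof.
rewrite /gibbs_kern /others /gkern -expRD; congr expR.
by rewrite /sqdev (bigD1 i)//= opprD mulrDl addrC.
Qed.

Lemma measurable_sqdev_param d' (D : measurableType d') (Q : pred 'I_n) (y : 'I_n -> D -> R) :
  (forall j, measurable_fun setT (y j)) ->
  measurable_fun setT (fun z : D * L => \sum_(j < n | Q j) (y j z.1 - g j z.2) ^+ 2).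
Proof.
move=> my; under eq_fun do rewrite -big_filter; apply: measurable_sum => j.
apply: measurable_funX; apply: measurable_funB.
  by apply: (measurableT_comp (my j)).
by apply: (measurableT_comp (mg j)).
Qed.

Lemma measurable_others_param d' (D : measurableType d') i (y : 'I_n -> D -> R) :
  (forall j, measurable_fun setT (y j)) ->
  measurable_fun setT (fun z : D * L => others i (y^~ z.1) z.2).
Proof.
move=> my; apply: measurableT_comp => //; apply: measurable_funM => //.
by apply: measurableT_comp => //; exact: measurable_sqdev_param.
Qed.

Lemma measurable_others i y : measurable_fun setT (others i y).
Proof.
have /= := @measurable_others_param _ L i (fun j _ => y j) (fun=> measurable_cst _).
move=> h; have := measurableT_comp h (measurable_pair1 point).
by apply.
Qed.

Lemma others_gt0 i y l : 0 < others i y l.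
Proof. exact: expR_gt0. Qed.

Lemma others_le1 i y l : others i y l <= 1.
Proof.
rewrite /others -expR0 ler_expR mulNr oppr_le0 divr_ge0 ?(ltW beta_gt0)//.
by apply: sumr_ge0 => j _; rewrite sqr_ge0.
Qed.

Let gmom_param d' (D : measurableType d') i k (y : 'I_n -> D -> R) (t : D -> R) :
  (forall j, measurable_fun setT (y j)) -> measurable_fun setT t ->
  measurable_fun setT (fun x => gmom mu beta (g i) (others i (y^~ x)) k (t x)).
Proof.
move=> my mt; apply: (@measurable_Rintegral_param _ _ _ mu _ _ (fun z : D * L =>
  others i (y^~ z.1) z.2 * g i z.2 ^+ k * gkern beta (t z.1) (g i z.2))).
have mg2 : measurable_fun setT (fun z : D * L => g i z.2).
  by apply: (measurableT_comp (mg i)).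
apply: measurable_funM; last first.
  by apply: measurable_gkern_param => //; apply: (measurableT_comp mt).
by apply: measurable_funM; [exact: measurable_others_param|exact: measurable_funX].
Qed.

Let gmom0_param d' (D : measurableType d') i (y : 'I_n -> D -> R) (t : D -> R) :
  (forall j, measurable_fun setT (y j)) -> measurable_fun setT t ->
  measurable_fun setT (fun x => (gmom mu beta (g i) (others i (y^~ x)) 0 (t x))^-1).
Proof.
move=> my mt.
(* The normalising constant is positive, so its inverse is [expR (- ln _)], a composition of
   measurable functions. *)
rewrite (_ : (fun _ => _) =
    fun x => expR (- ln (gmom mu beta (g i) (others i (y^~ x)) 0 (t x)))).
  apply: measurableT_comp => //; apply: measurableT_comp => //.
  by apply: (measurableT_comp (@measurable_ln R)); exact: gmom_param.
apply/funext => x; rewrite expRN lnK// posrE gmom0_gt0//.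
- exact: measurable_others.
- exact: others_gt0.
- exact: others_le1.
Qed.

Lemma measurable_gmean_param d' (D : measurableType d') i (y : 'I_n -> D -> R) (t : D -> R) :
  (forall j, measurable_fun setT (y j)) -> measurable_fun setT t ->
  measurable_fun setT (fun x => gmean mu beta (g i) (others i (y^~ x)) (t x)).
Proof.
move=> my mt; apply: measurable_funM; first exact: gmom_param.
exact: gmom0_param.
Qed.

Lemma measurable_gvar_param d' (D : measurableType d') i (y : 'I_n -> D -> R) (t : D -> R) :
  (forall j, measurable_fun setT (y j)) -> measurable_fun setT t ->
  measurable_fun setT (fun x => gvar mu beta (g i) (others i (y^~ x)) (t x)).
Proof.
move=> my mt; apply: measurable_funB; last first.
  by apply: measurable_funX; exact: measurable_gmean_param.
apply: measurable_funM; first exact: gmom_param.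
exact: gmom0_param.
Qed.

End posterior.

Section posterior_risk.
Context d (L : measurableType d) (R : realType) (mu : probability L R).
Context (n : nat) (g : 'I_n -> L -> R) (beta : R).
Hypothesis beta_gt0 : 0 < beta.
Hypothesis mg : forall i, measurable_fun setT (g i).

Local Notation pmean := (post_mean mu g beta).
Local Notation pvar := (post_var mu g beta).
Local Notation kern := (gibbs_kern g beta).

Let mo i y : measurable_fun setT (others g beta i y).
Proof. exact: measurable_others. Qed.
Let o0 i y l : 0 < others g beta i y l. Proof. exact: others_gt0. Qed.
Let o1 i y l : others g beta i y l <= 1. Proof. exact: others_le1. Qed.

(** The normalising constant is the same whichever coordinate [i] is singled out. *)
Lemma gmom0_gibbs i y :
  gmom mu beta (g i) (others g beta i y) 0 (y i) = \int[mu]_l kern y l.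
Proof. by apply: eq_Rintegral => l _; rewrite expr0 mulr1 -gibbs_kernE. Qed.

Lemma integrable_kern_sqr i y :
  mu.-integrable setT (EFin \o (fun l => kern y l * (y i - g i l) ^+ 2)).
Proof.
pose o := others g beta i y.
have i2 := integrable_gmom mu beta_gt0 (mg i) (mo i y) (o0 i y) (o1 i y) 2 (y i).
have i1 := integrableZl measurableT (- (y i *+ 2))
  (integrable_gmom mu beta_gt0 (mg i) (mo i y) (o0 i y) (o1 i y) 1 (y i)).
have i0 := integrableZl measurableT (y i ^+ 2)
  (integrable_gmom mu beta_gt0 (mg i) (mo i y) (o0 i y) (o1 i y) 0 (y i)).
have := integrableD measurableT (integrableD measurableT i2 i1) i0.
apply: eq_integrable => // l _ /=; rewrite -!EFinM -!EFinD; congr (_%:E).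
by rewrite (gibbs_kernE _ _ i); ring.
Qed.

(** Bias-variance decomposition of the squared residual under the posterior, before
    normalisation. *)
Lemma Rintegral_kern_sqr i y :
  \int[mu]_l (kern y l * (y i - g i l) ^+ 2) =
  (\int[mu]_l kern y l) * (pvar i y + (y i - pmean i y) ^+ 2).
Proof.
have z0 := gmom0_gt0 mu beta_gt0 (mg i) (mo i y) (o0 i y) (o1 i y) (y i).
transitivity (\int[mu]_l (others g beta i y l * (g i l - y i) ^+ 2 * gkern beta (y i) (g i l))).
  by apply: eq_Rintegral => l _; rewrite (gibbs_kernE _ _ i); ring.
rewrite (gmom_sqr mu beta_gt0 (mg i) (mo i y) (o0 i y) (o1 i y)) -(gmom0_gibbs i).
rewrite /pvar /pmean /gvar /gmean; field.
by rewrite gt_eqF.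
Qed.

Lemma integrable_kern y : mu.-integrable setT (EFin \o kern y).
Proof.
have mk : measurable_fun setT (kern y).
  apply: measurableT_comp => //; apply: measurable_funM => //.
  apply: measurableT_comp => //; apply: measurable_sum => j.
  by apply: measurable_funX; exact: measurable_funB.
apply: (@bounded_integrable _ _ _ mu (kern y) 1) => // l.
rewrite ger0_norm ?expR_ge0// -expR0 ler_expR mulNr oppr_le0.
by rewrite divr_ge0 ?(ltW beta_gt0)// sumr_ge0// => j _; rewrite sqr_ge0.
Qed.

Lemma Rintegral_kern_gt0 y : 0 < \int[mu]_l kern y l.
Proof.
apply: Rintegral_gt0; first exact: integrable_kern.
by move=> l; exact: expR_gt0.
Qed.

(* Since [1 + t <= exp t] at [t = s + ln Z], the Gibbs density [exp (- s) / Z]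
   has nonnegative relative entropy; this bounds its mean energy by [- ln Z]. *)
Lemma post_risk_le_ln y :
  \sum_(i < n) (pvar i y + (y i - pmean i y) ^+ 2) <=
  - (beta * ln (\int[mu]_l kern y l)).
Proof.
have Z0 := Rintegral_kern_gt0 y.
set Z := \int[mu]_l kern y l in Z0 *.
have ik := integrable_kern y.
have ikc c : mu.-integrable setT (EFin \o (fun l => c * kern y l)).
  by have := integrableZl measurableT c ik.
have iks : mu.-integrable setT (EFin \o
    (fun l => \sum_(i < n) kern y l * (y i - g i l) ^+ 2)).
  rewrite (_ : _ \o _ = fun l => (\sum_(i < n) (kern y l * (y i - g i l) ^+ 2)%:E)%E); last first.
    by apply/funext => l; rewrite /= sumEFin.
  by apply: integrable_sum => // i _; exact: integrable_kern_sqr.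
have iksb : mu.-integrable setT (EFin \o
    (fun l => beta^-1 * \sum_(i < n) kern y l * (y i - g i l) ^+ 2)).
  by have := integrableZl measurableT beta^-1 iks.
have iall : mu.-integrable setT (EFin \o
    (fun l => (1 + ln Z) * kern y l +
      beta^-1 * \sum_(i < n) kern y l * (y i - g i l) ^+ 2)).
  by have := integrableD measurableT (ikc (1 + ln Z)) iksb.
have : \int[mu]_l ((1 + ln Z) * kern y l +
      beta^-1 * \sum_(i < n) kern y l * (y i - g i l) ^+ 2) <= \int[mu]_l (cst Z l).
  apply: le_Rintegral => //.
    by apply: (@bounded_integrable _ _ _ mu _ `|Z|).
  move=> l _; rewrite -mulr_sumr -/(sqdev g y l) /cst.
  set s := sqdev g y l.
  have -> : (1 + ln Z) * kern y l + beta^-1 * (kern y l * s) =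
    kern y l * (1 + (s / beta + ln Z)) by ring.
  rewrite [leRHS](_ : Z = kern y l * expR (s / beta + ln Z)); last first.
    by rewrite expRD lnK ?posrE// mulrA -expRD /s mulNr addNr expR0 mul1r.
  by rewrite ler_wpM2l ?expR_ge0// expR_ge1Dx.
rewrite Rintegral_cst// [fine _](_ : _ = 1) ?mulr1; last first.
  exact: (congr1 fine (@probability_setT _ _ _ mu)).
rewrite RintegralD// !RintegralZl// Rintegral_sum; last by move=> i; exact: integrable_kern_sqr.
under eq_bigr do rewrite Rintegral_kern_sqr.
rewrite -mulr_sumr -/Z; set S := \sum_(i < n) _ => H.
have : Z * (ln Z + S / beta) <= 0.
  by move: H; rewrite mulrCA (mulrC _ S) -/Z; lra.
rewrite pmulr_rle0// -[in X in _ -> X](@ler_pM2r _ beta^-1) ?invr_gt0//.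
rewrite mulNr mulrAC divff ?gt_eqF// mul1r; lra.
Qed.

(** Turns a lower bound on the normalising integral into a comparison with the vector [h], at the
    price [beta * K]. *)
Lemma post_risk_le y (h : 'I_n -> R) (K : R) :
  expR (- (\sum_(i < n) (y i - h i) ^+ 2) / beta - K) <= \int[mu]_l kern y l ->
  \sum_(i < n) (pvar i y + (y i - pmean i y) ^+ 2) <=
  \sum_(i < n) (y i - h i) ^+ 2 + beta * K.
Proof.
move=> hK; apply: (le_trans (post_risk_le_ln y)).
have : - (\sum_(i < n) (y i - h i) ^+ 2) / beta - K <= ln (\int[mu]_l kern y l).
  by rewrite -ler_expR lnK// posrE Rintegral_kern_gt0.
rewrite -(ler_pM2l beta_gt0) mulrBr mulrCA divff ?gt_eqF// mulr1; lra.
Qed.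

Lemma post_var_ge0 i y : 0 <= pvar i y.
Proof. exact: gvar_ge0. Qed.

End posterior_risk.

(** * Gaussian noise *)

Section gaussian_noise.
Context d (T : measurableType d) (R : realType) (P : probability T R).
Context (n : nat) (xi : 'I_n -> {RV P >-> R}) (sigma : R).
Hypothesis sigma_gt0 : 0 < sigma.
Hypothesis xi_ind : mutually_independent xi.
Hypothesis xi_gauss : forall i, centered_gaussian sigma (xi i).
Local Notation fz := (freeze xi).

Let mxi i : measurable_fun setT (xi i : T -> R).
Proof. exact: measurable_funP. Qed.

(** Stein's inequality for the identity, whose derivative is 1. *)
Lemma integral_normal_prob_sqr_le :
  (\int[normal_prob 0 sigma]_u (u ^+ 2)%:E <= (sigma ^+ 2)%:E)%E.
Proof.
have cst1_cont : continuous (cst 1 : R -> R) by move=> x; exact: cvg_cst.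
have := @stein_le R sigma sigma_gt0 id (cst 1) (fun x => is_derive_id x 1)
  (fun _ => ler01) cst1_cont.
rewrite (_ : \int[_]_u (sigma ^+ 2 * cst 1 u)%:E = (sigma ^+ 2)%:E)%E; last first.
  rewrite (eq_integral (cst (sigma ^+ 2)%:E)); last first.
    by move=> u _; rewrite mulr1.
  rewrite integral_cst// [X in (_ * X)%E](_ : _ = 1%E) ?mule1//.
  exact: (@probability_setT _ _ _ (normal_prob 0 sigma)).
move=> H; apply: (le_trans _ H); rewrite le_eqVlt; apply/orP; left; apply/eqP.
by apply: eq_integral => u _; rewrite subr0 expr2.
Qed.

Lemma integrable_noise_sqr i : P.-integrable setT (EFin \o (fun w => xi i w ^+ 2)).
Proof.
have mx2 : measurable_fun setT (fun w => (xi i w ^+ 2)%:E).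
  by apply/measurable_EFinP; exact: measurable_funX.
apply/integrableP; split => //.
rewrite (eq_integral (fun w => (xi i w ^+ 2)%:E)); last first.
  by move=> w _ /=; rewrite ger0_norm ?sqr_ge0.
rewrite (@ge0_integral_freeze _ _ _ _ _ xi sigma xi_ind xi_gauss i
  (fun z => (z.1 ^+ 2)%:E)).
- rewrite /= integral_cst// [X in (_ * X)%E](_ : _ = 1%E) ?mule1; last first.
    exact: (@probability_setT _ _ _ P).
  exact: (le_lt_trans integral_normal_prob_sqr_le (ltry _)).
- by apply/measurable_EFinP; apply: measurable_funX.
- by move=> z; rewrite lee_fin sqr_ge0.
Qed.

(** The reflection [u |-> - u] preserves the centred normal law and exchanges the positive and
    negative parts of [u * c]. *)
Lemma integral_normal_prob_oddl (c : R) :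
  (\int[normal_prob 0 sigma]_u (Num.max (u * c) 0)%:E =
   \int[normal_prob 0 sigma]_u (Num.max (- (u * c)) 0)%:E)%E.
Proof.
have s0 : sigma != 0 by rewrite gt_eqF.
have m1 : measurable_fun setT (fun u : R => (Num.max (u * c) 0)%:E).
  apply/measurable_EFinP; apply: measurable_maxr => //; exact: measurable_funM.
have m2 : measurable_fun setT (fun u : R => (Num.max (- (u * c)) 0)%:E).
  apply/measurable_EFinP; apply: measurable_maxr => //.
  by apply: measurableT_comp => //; exact: measurable_funM.
have ge0 (x : R) : (0 <= (Num.max x 0)%:E)%E by rewrite lee_fin le_max lexx orbT.
rewrite !ge0_integral_normal_prob//.
pose F (u : R) := ((Num.max (u * c) 0)%:E * (normal_pdf 0 sigma u)%:E)%E.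
have mF : measurable_fun setT F.
  by apply: emeasurable_funM => //; apply/measurable_EFinP; exact: measurable_normal_pdf.
have F_ge0 u : (0 <= F u)%E by rewrite mule_ge0// lee_fin normal_pdf_ge0.
apply: (etrans (esym (ge0_integral_oppr mF F_ge0))).
apply: eq_integral => u _; rewrite /F mulNr.
by rewrite !normal_pdfE// /normal_fun !subr0 sqrrN.
Qed.

(** For fixed values of the other noises, the positive and negative parts have equal Gaussian
    integrals; integrability makes their difference 0 rather than an indeterminate form. *)
Lemma integral_noise_freeze i (h : n.-tuple R -> R) : measurable_fun setT h ->
  P.-integrable setT (EFin \o (fun w => xi i w * h (fz i w))) ->
  (\int[P]_w (xi i w * h (fz i w))%:E = 0)%E.
Proof.
move=> mh ih.
have mh2 : measurable_fun setT (fun z : R * n.-tuple R => z.1 * h z.2).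
  by apply: measurable_funM => //; apply: (measurableT_comp mh).
have ge0 (x : R) : (0 <= (Num.max x 0)%:E)%E by rewrite lee_fin le_max lexx orbT.
have mp : measurable_fun setT
    (fun z : R * n.-tuple R => (Num.max (z.1 * h z.2) 0)%:E).
  by apply/measurable_EFinP; exact: measurable_maxr.
have mn : measurable_fun setT
    (fun z : R * n.-tuple R => (Num.max (- (z.1 * h z.2)) 0)%:E).
  by apply/measurable_EFinP; apply: measurable_maxr => //; exact: measurableT_comp.
have E : (\int[P]_w (Num.max (xi i w * h (fz i w)) 0)%:E =
  \int[P]_w (Num.max (- (xi i w * h (fz i w))) 0)%:E)%E.
  apply: (etrans (ge0_integral_freeze xi_ind xi_gauss i mp (fun=> ge0 _))).
  apply: (etrans _ (esym (ge0_integral_freeze xi_ind xi_gauss i mn (fun=> ge0 _)))).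
  by apply: eq_integral => w _; exact: (integral_normal_prob_oddl (h (fz i w))).
rewrite integralE.
have Ep : (\int[P]_w (fun w => (xi i w * h (fz i w))%:E)^\+ w =
    \int[P]_w (Num.max (xi i w * h (fz i w)) 0)%:E)%E.
  by apply: eq_integral => w _; rewrite funeposE EFin_max.
have En : (\int[P]_w (fun w => (xi i w * h (fz i w))%:E)^\- w =
    \int[P]_w (Num.max (xi i w * h (fz i w)) 0)%:E)%E.
  rewrite E; apply: eq_integral => w _; by rewrite funenegE EFin_max.
rewrite Ep En subee// -Ep; exact: (integrable_pos_fin_num measurableT ih).
Qed.

End gaussian_noise.

(** * Oracle inequality for a general prior *)

Section gibbs_oracle.
Context d (T : measurableType d) (R : realType) (P : probability T R).
Context (n : nat) (xi : 'I_n -> {RV P >-> R}) (sigma : R).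
Hypothesis sigma_gt0 : 0 < sigma.
Hypothesis xi_ind : mutually_independent xi.
Hypothesis xi_gauss : forall i, centered_gaussian sigma (xi i).
Context d' (L : measurableType d') (mu : probability L R).
Context (g : 'I_n -> L -> R) (beta : R).
Hypothesis beta_ge : 4 * sigma ^+ 2 <= beta.
Hypothesis mg : forall i, measurable_fun setT (g i).
Variables (f h : 'I_n -> R) (K : R).
(** [h] stands for the values of the oracle at the design points, and [K] for the cost of reaching
    it from the prior [mu]. *)
Hypothesis hK : forall y : 'I_n -> R,
  expR (- (\sum_(i < n) (y i - h i) ^+ 2) / beta - K) <=
  \int[mu]_l gibbs_kern g beta y l.

Local Notation pmean := (post_mean mu g beta).
Local Notation pvar := (post_var mu g beta).
Local Notation fz := (freeze xi).

Let beta_gt0 : 0 < beta.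
Proof. by rewrite (lt_le_trans _ beta_ge)// mulr_gt0// exprn_gt0. Qed.

Let Y (w : T) (i : 'I_n) : R := f i + xi i w.
(** At [v = fz i w] this is the observation with its [i]-th noise set to 0; as [others g beta i]
    ignores coordinate [i], it is unaffected by the freezing. *)
Let Yt (v : n.-tuple R) (i : 'I_n) : R := f i + tnth v i.

Let mxi i : measurable_fun setT (xi i : T -> R).
Proof. exact: measurable_funP. Qed.

Let mY i : measurable_fun setT (Y^~ i).
Proof. exact: measurable_funD. Qed.

Let mYt i : measurable_fun setT (Yt^~ i).
Proof. by apply: measurable_funD => //; exact: measurable_tnth. Qed.

Let mo i y : measurable_fun setT (others g beta i y).
Proof. exact: measurable_others. Qed.
Let o0 i y l : 0 < others g beta i y l. Proof. exact: others_gt0. Qed.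
Let o1 i y l : others g beta i y l <= 1. Proof. exact: others_le1. Qed.

Let others_freeze i w : others g beta i (Yt (fz i w)) = others g beta i (Y w).
Proof.
apply/funext => l; rewrite /others.
rewrite (eq_bigr (fun j => (Y w j - g j l) ^+ 2))// => j /negbTE ji.
by rewrite /Yt tnth_mktuple ji.
Qed.

Let mt i (v : n.-tuple R) := gmean mu beta (g i) (others g beta i (Yt v)).

Let mean_mt i w : pmean i (Y w) = mt i (fz i w) (f i + xi i w).
Proof. by rewrite /mt others_freeze. Qed.

Let frozen_mt i w : pmean i (Yt (fz i w)) = mt i (fz i w) (f i).
Proof. by rewrite /post_mean /mt {2}/Yt tnth_mktuple eqxx addr0. Qed.

Let V i w := pvar i (Y w).
(** [D i + Z i] splits [2 * xi i * (pmean i - h i)]. [D i] is the response of the posterior mean to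
    its own noise, nonnegative and controlled by Stein's inequality; [Z i] is [xi i] times a
    function of the other noises, hence centred. [S] is an integrable majorant. *)
Let D i w := 2 * xi i w * (pmean i (Y w) - mt i (fz i w) (f i)).
Let Z i w := 2 * xi i w * (mt i (fz i w) (f i) - h i).
Let S w := \sum_(j < n) (2 * (f j - h j) ^+ 2 + 2 * xi j w ^+ 2) + beta * K.

Let V_ge0 i w : 0 <= V i w.
Proof. exact: post_var_ge0. Qed.

Let D_ge0 i w : 0 <= D i w.
Proof. by rewrite /D mean_mt -mulrA mulr_ge0// gmean_incr. Qed.

Let mV i : measurable_fun setT (V i).
Proof. exact: (measurable_gvar_param mu beta_gt0 mg i mY (mY i)). Qed.

Let mmt i : measurable_fun setT (fun v => mt i v (f i)).
Proof. exact: (measurable_gmean_param mu beta_gt0 mg i mYt (measurable_cst _)). Qed.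

Let mmtf i : measurable_fun setT (fun w => mt i (fz i w) (f i)).
Proof. apply: (measurableT_comp (mmt i)); exact: measurable_freeze. Qed.

Let mmean i : measurable_fun setT (fun w => pmean i (Y w)).
Proof. exact: (measurable_gmean_param mu beta_gt0 mg i mY (mY i)). Qed.

Let mD i : measurable_fun setT (D i).
Proof. by apply: measurable_funM; [exact: measurable_funM|exact: measurable_funB]. Qed.

Let mZ i : measurable_fun setT (Z i).
Proof. by apply: measurable_funM; [exact: measurable_funM|exact: measurable_funB]. Qed.

Let iS : P.-integrable setT (EFin \o S).
Proof.
have ixi := integrable_noise_sqr sigma_gt0 xi_ind xi_gauss.
have ic (c : R) : P.-integrable setT (EFin \o cst c).
  by apply: (@bounded_integrable _ _ _ P _ `|c|).
have i1 : P.-integrable setT (fun w => \sum_(j < n)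
    ((2 * (f j - h j) ^+ 2)%:E + 2%:E * (xi j w ^+ 2)%:E))%E.
  apply: integrable_sum => // j _; apply: integrableD => //; first exact: ic.
  by have := integrableZl measurableT 2 (ixi j).
have := integrableD measurableT i1 (ic (beta * K)).
apply: eq_integrable => // w _; rewrite /S [RHS]/= [RHS]EFinD -sumEFin.
by congr (_ + _)%E.
Qed.

Let sqr_sum_le (a b : R) : (a + b) ^+ 2 <= 2 * a ^+ 2 + 2 * b ^+ 2.
Proof. by rewrite -subr_ge0 (_ : _ - _ = (a - b) ^+ 2) ?sqr_ge0//; ring. Qed.

(** One term of [post_risk_le], the others being nonnegative. It serves for the observation [Y w]
    and for its frozen version. *)
Let risk_le_S w (y : 'I_n -> R) i :
  (forall j, (y j - h j) ^+ 2 <= 2 * (f j - h j) ^+ 2 + 2 * xi j w ^+ 2) ->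
  pvar i y + (y i - pmean i y) ^+ 2 <= S w.
Proof.
move=> yS; have := post_risk_le beta_gt0 mg (hK y).
rewrite (bigD1 i)//= => H; apply: le_trans (le_trans _ H) _.
  rewrite lerDl; apply: sumr_ge0 => j _.
  by rewrite addr_ge0 ?sqr_ge0// post_var_ge0.
by rewrite lerD2r; exact: ler_sum.
Qed.

Let V_le_S i w : V i w <= S w.
Proof.
apply: (le_trans _ (@risk_le_S w (Y w) i _)) => [|j]; first by rewrite lerDl sqr_ge0.
by rewrite /Y (_ : f j + xi j w - h j = (f j - h j) + xi j w) ?sqr_sum_le//; ring.
Qed.

Let frozen_le_S i w : (f i - mt i (fz i w) (f i)) ^+ 2 <= S w.
Proof.
have := @risk_le_S w (Yt (fz i w)) i.
rewrite frozen_mt {3}/Yt tnth_mktuple eqxx addr0 => H.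
apply: le_trans (H _) => [|j]; first by rewrite lerDr post_var_ge0.
rewrite /Yt tnth_mktuple; case: ifP => _.
  rewrite addr0 -[leLHS]addr0; apply: lerD.
    by rewrite ler_peMl ?sqr_ge0// ler1n.
  by apply: mulr_ge0 => //; exact: sqr_ge0.
by rewrite (addrAC (f j)) sqr_sum_le.
Qed.

Let iV i : P.-integrable setT (EFin \o V i).
Proof.
apply: le_integrable iS => //; first exact/measurable_EFinP.
move=> w _ /=; rewrite lee_fin (ger0_norm (V_ge0 _ _)).
by rewrite (le_trans (V_le_S i w))// ler_norm.
Qed.

(** [stein_gmean] at [b = f i] for each fixed value of the other noises, averaged over them. *)
Let int_DV i : (\int[P]_w (D i w)%:E <= \int[P]_w (V i w)%:E)%E.
Proof.
pose H1 (z : R * n.-tuple R) : \bar R :=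
  (2 * z.1 * (mt i z.2 (f i + z.1) - mt i z.2 (f i)))%:E.
pose H2 (z : R * n.-tuple R) : \bar R :=
  (gvar mu beta (g i) (others g beta i (Yt z.2)) (f i + z.1))%:E.
have mfz1 : measurable_fun setT (fun z : R * n.-tuple R => f i + z.1).
  exact: measurable_funD.
have mYt2 j : measurable_fun setT (fun z : R * n.-tuple R => Yt z.2 j).
  by apply: (measurableT_comp (mYt j)).
have mH1 : measurable_fun setT H1.
  apply/measurable_EFinP/measurable_funM; first exact: measurable_funM.
  apply: measurable_funB; last by apply: (measurableT_comp (mmt i)).
  exact: (measurable_gmean_param mu beta_gt0 mg i mYt2 mfz1).
have mH2 : measurable_fun setT H2.
  apply/measurable_EFinP.
  exact: (measurable_gvar_param mu beta_gt0 mg i mYt2 mfz1).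
have H1_ge0 z : (0 <= H1 z)%E.
  by rewrite lee_fin -mulrA mulr_ge0// gmean_incr.
have H2_ge0 z : (0 <= H2 z)%E by rewrite lee_fin gvar_ge0.
rewrite (_ : \int[P]_w (D i w)%:E = \int[P]_w H1 (xi i w, fz i w))%E; last first.
  by apply: eq_integral => w _; rewrite /D mean_mt.
rewrite (_ : \int[P]_w (V i w)%:E = \int[P]_w H2 (xi i w, fz i w))%E; last first.
  by apply: eq_integral => w _; rewrite /V /H2/= others_freeze.
apply: (ge0_le_integral_freeze xi_ind xi_gauss i mH1 H1_ge0 mH2 H2_ge0) => v.
have := stein_gmean mu beta_gt0 (mg i) (mo i (Yt v)) (o0 i (Yt v)) (o1 i (Yt v))
  (f i) sigma_gt0 beta_ge.
by [].
Qed.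

Let iD i : P.-integrable setT (EFin \o D i).
Proof.
apply/integrableP; split; first exact/measurable_EFinP.
under eq_integral do rewrite /= (ger0_norm (D_ge0 _ _)).
apply: le_lt_trans (int_DV i) _.
have /integrableP[_] := iV i.
by under eq_integral do rewrite /= (ger0_norm (V_ge0 _ _)).
Qed.

Let iZ i : P.-integrable setT (EFin \o Z i).
Proof.
have ixi := integrable_noise_sqr sigma_gt0 xi_ind xi_gauss i.
have ic : P.-integrable setT (EFin \o cst (2 * (f i - h i) ^+ 2)).
  by apply: (@bounded_integrable _ _ _ P _ `|2 * (f i - h i) ^+ 2|).
have i3 := integrableD measurableT (integrableD measurableT ixi
  (integrableZl measurableT 2 iS)) ic.
apply: le_integrable i3 => //; first exact/measurable_EFinP.
move=> w _; rewrite /= lee_fin.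
apply: le_trans (ler_norm _); rewrite /Z.
have := frozen_le_S i w; set b := mt _ _ _; set t := xi i w => H.
have H2 : (b - h i) ^+ 2 <= 2 * (f i - b) ^+ 2 + 2 * (f i - h i) ^+ 2.
  by rewrite (_ : b - h i = - (f i - b) + (f i - h i)) ?(le_trans (sqr_sum_le _ _)) ?sqrrN//; ring.
have H3 : `|2 * t * (b - h i)| <= t ^+ 2 + (b - h i) ^+ 2.
  have sqD := sqr_ge0 (t + (b - h i)); have sqB := sqr_ge0 (t - (b - h i)).
  rewrite sqrrD in sqD; rewrite sqrrB in sqB.
  by rewrite -mulrA mulr_natl ler_norml; apply/andP; split; lra.
by lra.
Qed.

Let int_Z i : \int[P]_w Z i w = 0.
Proof.
rewrite /Rintegral (_ : \int[P]_w (Z i w)%:E = 0)%E//.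
transitivity (\int[P]_w (xi i w * (2 * (mt i (fz i w) (f i) - h i)))%:E)%E.
  by apply: eq_integral => w _; rewrite /Z; congr (_%:E); ring.
apply: (@integral_noise_freeze _ _ _ _ _ xi sigma sigma_gt0 xi_ind xi_gauss i
  (fun v => 2 * (mt i v (f i) - h i))).
  by apply: measurable_funM => //; exact: measurable_funB.
by apply: eq_integrable (iZ i) => // w _ /=; rewrite /Z; congr (_%:E); ring.
Qed.

(** Expanding the squares in [post_risk_le] bounds the loss pointwise by [C] plus the sum of
    [D i + Z i - V i]; in expectation [Z i] vanishes and [V i] outweighs [D i]. *)
Lemma gibbs_oracle :
  (\int[P]_w (\sum_(i < n) (pmean i (fun j => (f j + xi j w)%R) - f i) ^+ 2)%:E <=
   (\sum_(i < n) (h i - f i) ^+ 2 + beta * K)%:E)%E.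
Proof.
pose C := \sum_(i < n) (h i - f i) ^+ 2 + beta * K.
pose U i w := D i w + Z i w - V i w.
have iU i : P.-integrable setT (EFin \o U i).
  by have := integrableB measurableT (integrableD measurableT (iD i) (iZ i)) (iV i).
have iUs : P.-integrable setT (EFin \o (fun w => \sum_(i < n) U i w)).
  rewrite (_ : _ \o _ = fun w => (\sum_(i < n) (U i w)%:E)%E); last first.
    by apply/funext => w; rewrite /= sumEFin.
  by apply: integrable_sum => // i _; exact: iU.
have iC : P.-integrable setT (EFin \o cst C).
  by apply: (@bounded_integrable _ _ _ P _ `|C|).
have iCU : P.-integrable setT (EFin \o (fun w => C + \sum_(i < n) U i w)).
  by have := integrableD measurableT iC iUs.
have risk w : \sum_(i < n) (pmean i (Y w) - f i) ^+ 2 <= C + \sum_(i < n) U i w.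
  have := post_risk_le beta_gt0 mg (hK (Y w)).
  have -> : C + \sum_(i < n) U i w = (\sum_(i < n) (Y w i - h i) ^+ 2 + beta * K) +
      \sum_(i < n) ((pmean i (Y w) - f i) ^+ 2 - (pvar i (Y w) + (Y w i - pmean i (Y w)) ^+ 2)).
    rewrite /C addrAC [RHS]addrAC; congr (_ + _); rewrite -!big_split/=.
    apply: eq_bigr => i _; rewrite /U /D /Z /V /Y; ring.
  rewrite sumrB; lra.
apply: (@le_trans _ _ (\int[P]_w (C + \sum_(i < n) U i w)%:E)%E).
  apply: ge0_le_integral => //.
  - by move=> w _; rewrite lee_fin sumr_ge0// => i _; rewrite sqr_ge0.
  - apply/measurable_EFinP/measurable_sum => i.
    by apply: measurable_funX; exact: measurable_funB.
  - by case/integrableP : iCU.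
  - by move=> w _; rewrite lee_fin; exact: risk.
rewrite -[leLHS]fineK; last exact: (integrable_fin_num measurableT iCU).
rewrite lee_fin -/(Rintegral _ _ _) RintegralD//.
rewrite Rintegral_cst// [fine _](_ : _ = 1) ?mulr1; last first.
  exact: (congr1 fine (@probability_setT _ _ _ P)).
rewrite Rintegral_sum// gerDl; apply: sumr_le0 => i _.
rewrite RintegralB//; last by have := integrableD measurableT (iD i) (iZ i).
rewrite RintegralD// int_Z addr0 subr_le0 /Rintegral fine_le//.
- exact: (integrable_fin_num measurableT (iD i)).
- exact: (integrable_fin_num measurableT (iV i)).
Qed.

End gibbs_oracle.

(** * The penalty and the sparsity prior *)

Section penalty.
Context {R : realType}.

Lemma ln_sum_le (I : finType) (J : {set I}) (a : I -> R) :
  (forall j, 0 <= a j) ->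
  \sum_(j in J) ln (1 + a j) <= #|J|%:R * ln (1 + (\sum_(j in J) a j) / #|J|%:R).
Proof.
(* For empty [J] the quotient by [#|J|] is a division by zero, but both sides are 0. *)
move=> a0; have [J0|J0] := posnP #|J|.
  by rewrite J0 mul0r big1// => j; rewrite (cards0_eq J0) inE.
have m0 : 0 < #|J|%:R :> R by rewrite ltr0n.
set c := 1 + _.
have c0 : 0 < c by rewrite ltr_wpDr// divr_ge0 ?sumr_ge0// ltW.
(* Tangent to [ln] at the average [c] of the [1 + a j]. *)
have tangent j : ln (1 + a j) <= ln c + ((1 + a j) / c - 1).
  have aj0 : 0 < 1 + a j by rewrite ltr_wpDr.
  rewrite -lerBlDl -ln_div ?posrE//.
  rewrite -[X in ln X](subrKC 1) le_ln1Dx//.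
  by rewrite ltrBrDl subrr divr_gt0.
apply: le_trans (ler_sum _ (fun j _ => tangent j)) _.
rewrite big_split/= sumr_const sumrB sumr_const -mulr_suml big_split/=.
rewrite sumr_const.
have -> : 1 *+ #|J| + \sum_(j in J) a j = #|J|%:R * c.
  by rewrite /c; field; rewrite gt_eqF.
by rewrite mulfK ?gt_eqF// subrr addr0 mulr_natl.
Qed.

(** For [s <= 1], [ln (1 + s) <= s <= 1]; for [s > 1], [ln (1 + s) = ln s + ln (1 + 1 / s)] and the
    last term is at most [1 / s]. *)
Lemma ln1D_le_log_plus (s : R) : 0 <= s -> ln (1 + s) <= 1 + log_plus s.
Proof.
move=> s0; rewrite /log_plus; have [s1|s1] := leP s 1.
  apply: (@le_trans _ _ s); first by rewrite le_ln1Dx// (lt_le_trans _ s0)// ltrN10.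
  by rewrite (le_trans s1)// lerDl le_max lexx orbT.
have sgt0 : 0 < s by rewrite (lt_trans _ s1).
rewrite (_ : 1 + s = s * (1 + s^-1)); last by field; rewrite gt_eqF.
rewrite lnM ?posrE ?ltr_wpDr ?invr_ge0// addrC lerD//; last by rewrite le_max lexx.
apply: (@le_trans _ _ s^-1).
  by rewrite le_ln1Dx// (@lt_le_trans _ _ 0) ?ltrN10// invr_ge0.
by rewrite invf_le1// ltW.
Qed.

(** Zero coordinates contribute [ln 1 = 0], so the sum runs over the support; averaging there by
    concavity brings in the sparsity. *)
Lemma ln_shift_cost_le (M : nat) (tau : R) (lambda : M.-tuple R) : 0 < tau ->
  ln (\prod_(j < M) (1 + `|tnth lambda j| / tau) ^+ 4) <=
  4 * (nb_nonzero lambda)%:R *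
    (1 + log_plus (tau^-1 / (nb_nonzero lambda)%:R * l1norm lambda)).
Proof.
move=> tau0; set a := fun j => `|tnth lambda j| / tau.
have a0 j : 0 <= a j by rewrite divr_ge0// ltW.
have -> : \prod_(j < M) (1 + a j) ^+ 4 = expR (\sum_(j < M) 4 * ln (1 + a j)).
  rewrite expR_sum; apply: eq_bigr => j _.
  by rewrite expRM_natl lnK// posrE ltr_wpDr.
rewrite expRK -mulr_sumr -mulrA ler_pM2l//.
pose J := [set j : 'I_M | tnth lambda j != 0]%SET.
(* [nb_nonzero] is the cardinal of a classical set, [J] is a finite set. *)
have nbE : nb_nonzero lambda = #|J|.
  by apply: eq_card => j; rewrite [RHS]inE; apply/idP/idP => [/set_mem|/mem_set].
have sumJ (F : 'I_M -> R) : (forall j, tnth lambda j = 0 -> F j = 0) ->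
    \sum_(j < M) F j = \sum_(j in J) F j.
  move=> F0; rewrite [RHS]big_mkcond/=; apply: eq_bigr => j _.
  by rewrite inE; case: eqP => // /F0.
rewrite sumJ; last by move=> j j0; rewrite /a j0 normr0 mul0r addr0 ln1.
apply: le_trans (ln_sum_le J a0) _.
rewrite nbE ler_wpM2l//.
rewrite (_ : tau^-1 / _ * _ = (\sum_(j in J) a j) / #|J|%:R); last first.
  rewrite -mulr_suml -sumJ; last by move=> j ->; rewrite normr0.
  by rewrite /l1norm; ring.
by apply: ln1D_le_log_plus; rewrite divr_ge0// sumr_ge0.
Qed.

End penalty.

(** * Linear combinations under the sparsity prior *)

Section linear_model.
Context (R : realType) (X : Type) (n M : nat).
Context (x : 'I_n -> X) (phi : 'I_M -> X -> R) (beta : R) (tau : {posnum R}).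
Hypothesis beta_gt0 : 0 < beta.
Hypothesis n_gt0 : (0 < n)%N.
Let mu : probability (M.-tuple R) R := sparsity_prior M tau.
Let g (i : 'I_n) (l : M.-tuple R) := lincomb phi l (x i).

Lemma measurable_lincomb z : measurable_fun setT (fun l => lincomb phi l z).
Proof.
apply: measurable_sum => j; apply: measurable_funM => //.
exact: measurable_tnth.
Qed.

Lemma gibbsE y : gibbs x phi beta y = gibbs_kern g beta y.
Proof.
apply/funext => l; rewrite /gibbs /gibbs_kern /sqnorm_dist mulrA divff ?mul1r//.
by rewrite pnatr_eq0 -lt0n.
Qed.

(** At each design point the aggregate is a posterior mean in the form that [gibbs_oracle]
    handles. *)
Lemma ewaE y i :
  ewa x phi beta (sparsity_prior M tau) y (x i) = post_mean mu g beta i y.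
Proof.
have mg j : measurable_fun setT (g j) by exact: measurable_lincomb.
have mo : measurable_fun setT (others g beta i y) by exact: measurable_others.
have o0 l : 0 < others g beta i y l by exact: others_gt0.
have o1 l : others g beta i y l <= 1 by exact: others_le1.
rewrite /ewa /ewa_weight gibbsE /post_mean /gmean gmom0_gibbs.
rewrite -[RHS]mulrC -RintegralZl//; last first.
  exact: (integrable_gmom mu beta_gt0 (mg i) mo o0 o1 1 (y i)).
apply: eq_Rintegral => l _.
by rewrite (gibbs_kernE _ _ i) expr1 -/(g i l); ring.
Qed.

Lemma lincomb_tuple_add (s t : M.-tuple R) z :
  lincomb phi (tuple_add s t) z = lincomb phi s z + lincomb phi t z.
Proof.
rewrite /lincomb -big_split/=; apply: eq_bigr => j _.
by rewrite tnth_mktuple mulrDl.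
Qed.

Lemma integral_prior_lincomb_sqr (b : R) i :
  (\int[mu]_t ((b - lincomb phi t (x i)) ^+ 2)%:E =
  (b ^+ 2 + tau%:num ^+ 2 * \sum_(j < M) phi j (x i) ^+ 2)%:E)%E.
Proof.
rewrite (eq_bigr (fun j => (- phi j (x i)) ^+ 2)); last by move=> j _; rewrite sqrrN.
rewrite -[RHS](integral_sparsity_prior_sqr tau b (fun j => - phi j (x i))).
apply: eq_integral => t _; congr ((b + _) ^+ 2)%:E.
by rewrite /lincomb -sumrN; apply: eq_bigr => j _; rewrite mulNr mulrC.
Qed.

Lemma tr_gram : n%:R * \tr (gram x phi) = \sum_(i < n) \sum_(j < M) phi j (x i) ^+ 2.
Proof.
rewrite /mxtrace exchange_big/= mulr_sumr; apply: eq_bigr => j _.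
rewrite mxE mulrA divff ?mul1r; last by rewrite pnatr_eq0 -lt0n.
by apply: eq_bigr => i _; rewrite expr2.
Qed.

(** Provides the hypothesis on the normalising integral in [gibbs_oracle]: translate the prior by
    [s], then apply Jensen's inequality. *)
Lemma gibbs_lower_bound (y : 'I_n -> R) (s : M.-tuple R) :
  expR (- (\sum_(i < n) (y i - lincomb phi s (x i)) ^+ 2) / beta -
    (ln (\prod_(j < M) (1 + `|tnth s j| / tau%:num) ^+ 4) +
     tau%:num ^+ 2 * (n%:R * \tr (gram x phi)) / beta)) <=
  \int[mu]_l gibbs_kern g beta y l.
Proof.
have mg i : measurable_fun setT (g i) by exact: measurable_lincomb.
set C := \prod_(j < M) _.
have C0 : 0 < C.
  by apply: prodr_gt0 => j _; rewrite exprn_gt0// ltr_wpDr// divr_ge0.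
pose q i t := (y i - lincomb phi s (x i) - lincomb phi t (x i)) ^+ 2.
have mq i : measurable_fun setT (q i).
  by apply: measurable_funX; apply: measurable_funB => //; exact: measurable_lincomb.
have iq i : mu.-integrable setT (EFin \o q i).
  apply/integrableP; split; first exact/measurable_EFinP.
  under eq_integral do rewrite /= ger0_norm ?sqr_ge0//.
  by rewrite integral_prior_lincomb_sqr ltry.
have int_q i : \int[mu]_t q i t = (y i - lincomb phi s (x i)) ^+ 2 +
    tau%:num ^+ 2 * \sum_(j < M) phi j (x i) ^+ 2.
  by rewrite /Rintegral integral_prior_lincomb_sqr.
(* The prior mean of the energy of [tuple_add s t]: the energy of [s] plus the spread of the
   prior. *)
pose c := (\sum_(i < n) (y i - lincomb phi s (x i)) ^+ 2 +
  tau%:num ^+ 2 * (n%:R * \tr (gram x phi))) / beta.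
have int_qs : \int[mu]_t (beta^-1 * \sum_(i < n) q i t) = c.
  have iqs : mu.-integrable setT (EFin \o (fun t => \sum_(i < n) q i t)).
    rewrite (_ : _ \o _ = fun w => (\sum_(i < n) (q i w)%:E)%E); last first.
      by apply/funext => w; rewrite /= sumEFin.
    by apply: integrable_sum => // i _; exact: iq.
  rewrite RintegralZl// Rintegral_sum// (eq_bigr _ (fun i _ => int_q i)).
  by rewrite big_split/= -mulr_sumr -tr_gram mulrC.
have iqs : mu.-integrable setT (EFin \o (fun t => beta^-1 * \sum_(i < n) q i t)).
  rewrite (_ : _ \o _ = fun w => (beta^-1%:E * \sum_(i < n) (q i w)%:E)%E); last first.
    by apply/funext => w; rewrite /= sumEFin.
  by apply: integrableZl => //; apply: integrable_sum => // i _; exact: iq.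
have kern_shift t : gibbs_kern g beta y (tuple_add s t) =
    expR (- (beta^-1 * \sum_(i < n) q i t)).
  rewrite /gibbs_kern; congr expR; rewrite mulNr mulrC; congr (- (_ * _)).
  by apply: eq_bigr => i _; rewrite /g lincomb_tuple_add opprD addrA.
have mshift : measurable_fun setT (fun t => gibbs_kern g beta y (tuple_add s t)).
  have /integrableP[/measurable_EFinP mk _] := integrable_kern mu beta_gt0 mg y.
  by apply: (measurableT_comp mk); exact: measurable_tuple_add.
have ishift : mu.-integrable setT
    (EFin \o (fun t => gibbs_kern g beta y (tuple_add s t))).
  apply: (@bounded_integrable _ _ _ mu _ 1) => // l.
  rewrite ger0_norm ?expR_ge0// -expR0 ler_expR mulNr oppr_le0.
  by rewrite divr_ge0 ?(ltW beta_gt0)// sumr_ge0// => j _; rewrite sqr_ge0.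
(* Jensen's inequality, from the tangent to [exp] at [- c]. *)
have jensen : expR (- c) <= \int[mu]_t gibbs_kern g beta y (tuple_add s t).
  have ic (k : R) : mu.-integrable setT (EFin \o cst k).
    by apply: (@bounded_integrable _ _ _ mu _ `|k|).
  have i1 : mu.-integrable setT
      (EFin \o (fun t => 1 + c - beta^-1 * \sum_(i < n) q i t)).
    by have := integrableB measurableT (ic (1 + c)) iqs.
  have i2 : mu.-integrable setT
      (EFin \o (fun t => expR (- c) * (1 + c - beta^-1 * \sum_(i < n) q i t))).
    by have := integrableZl measurableT (expR (- c)) i1.
  have -> : expR (- c) =
      \int[mu]_t (expR (- c) * (1 + c - beta^-1 * \sum_(i < n) q i t)).
    rewrite RintegralZl// RintegralB//; last exact: ic.
    rewrite int_qs Rintegral_cst// [fine _](_ : _ = 1); last first.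
      exact: (congr1 fine (@probability_setT _ _ _ mu)).
    by rewrite mulr1 addrK mulr1.
  apply: le_Rintegral => // t _; rewrite kern_shift.
  set r := beta^-1 * _.
  rewrite [X in _ <= expR X](_ : _ = - c + (c - r)); last by ring.
  by rewrite expRD ler_wpM2l ?expR_ge0// -addrA expR_ge1Dx.
have shift : \int[mu]_t gibbs_kern g beta y (tuple_add s t) <=
    C * \int[mu]_t gibbs_kern g beta y t.
  have ik := integrable_kern mu beta_gt0 mg y.
  have mk : measurable_fun setT (EFin \o gibbs_kern g beta y) by case/integrableP : ik.
  have k0 t : (0 <= (EFin \o gibbs_kern g beta y) t)%E by rewrite lee_fin expR_ge0.
  have := sparsity_prior_shift tau s mk k0.
  rewrite -lee_fin EFinM /Rintegral.
  rewrite (fineK (integrable_fin_num measurableT ishift)).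
  by rewrite (fineK (integrable_fin_num measurableT ik)).
rewrite -(ler_pM2l C0); apply: le_trans (le_trans jensen shift).
rewrite le_eqVlt; apply/orP; left; apply/eqP.
rewrite -{1}(lnK C0) -expRD /c; congr expR; ring.
Qed.

End linear_model.

(** * The sparsity oracle inequality *)

Theorem theorem6 (R : realType) (X : Type) (n M : nat)
    (x : 'I_n -> X) (f : X -> R) (phi : 'I_M -> X -> R)
    (d : measure_display) (T : measurableType d) (P : probability T R)
    (xi : 'I_n -> {RV P >-> R}) (sigma beta : R) (tau : {posnum R}) :
  0 < sigma ->
  mutually_independent xi ->
  (forall i, centered_gaussian sigma (xi i)) ->
  4 * sigma ^+ 2 <= beta ->
  0 < \tr (gram x phi) ->
  tau%:num = sigma / Num.sqrt (n%:R * \tr (gram x phi)) ->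
  let Y (w : T) (i : 'I_n) : R := f (x i) + xi i w in
  let fhat (w : T) : X -> R :=
    ewa x phi beta (sparsity_prior M tau) (Y w) in
  forall lambda : M.-tuple R,
    ('E_P[fun w => sqnorm_dist (fhat w \o x) (f \o x)] <=
     (sqnorm_dist (lincomb phi lambda \o x) (f \o x)
      + 4 * beta * (nb_nonzero lambda)%:R / n%:R
        * (1 + log_plus (Num.sqrt (n%:R * \tr (gram x phi))
                         / ((nb_nonzero lambda)%:R * sigma) * l1norm lambda))
      + sigma ^+ 2 / n%:R)%:E)%E.
Proof.
move=> s0 xi_ind xi_gauss beta_ge tr0 tauE Y fhat lambda.
have beta_gt0 : 0 < beta by rewrite (lt_le_trans _ beta_ge)// mulr_gt0// exprn_gt0.
(* For [n = 0] the convention [0^-1 = 0] makes the Gram matrix zero, against the positive trace. *)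
have n_gt0 : (0 < n)%N.
  rewrite lt0n; apply: contraTneq tr0 => n0; rewrite -leNgt.
  rewrite /mxtrace big1// => j _; rewrite mxE.
  by rewrite (_ : n%:R = 0 :> R) ?invr0 ?mul0r// n0.
have tau_gt0 : 0 < tau%:num by [].
have nR : 0 < n%:R :> R by rewrite ltr0n.
set tr := n%:R * \tr (gram x phi) in tauE *.
have tr_gt0 : 0 < tr by rewrite mulr_gt0.
have sqrt_gt0 : 0 < Num.sqrt tr by rewrite sqrtr_gt0.
(* This fixes the scale [tau]: the spread of the prior costs exactly [sigma ^+ 2], the last term of
   the bound once divided by [n]. *)
have tau2 : tau%:num ^+ 2 * tr = sigma ^+ 2.
  rewrite tauE expr_div_n sqr_sqrtr ?(ltW tr_gt0)// divfK// gt_eqF//.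
pose g (i : 'I_n) (l : M.-tuple R) := lincomb phi l (x i).
pose mu : probability (M.-tuple R) R := sparsity_prior M tau.
have mg i : measurable_fun setT (g i) by exact: measurable_lincomb.
pose C := \prod_(j < M) (1 + `|tnth lambda j| / tau%:num) ^+ 4.
pose K := ln C + sigma ^+ 2 / beta.
have hK y : expR (- (\sum_(i < n) (y i - lincomb phi lambda (x i)) ^+ 2) / beta - K) <=
    \int[mu]_l gibbs_kern g beta y l.
  by rewrite /K -tau2; exact: gibbs_lower_bound.
have oracle := gibbs_oracle s0 xi_ind xi_gauss beta_ge mg (fun i => f (x i)) hK.
rewrite unlock.
under eq_integral => w _.
  rewrite /sqnorm_dist /fhat.
  under eq_bigr => i _ do rewrite /comp (ewaE x phi tau beta_gt0 n_gt0).
  rewrite EFinM.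
  over.
have mY i : measurable_fun setT (Y^~ i).
  by apply: measurable_funD => //; exact: measurable_funP.
rewrite ge0_integralZl//; last 2 first.
- apply/measurable_EFinP/measurable_sum => i; apply: measurable_funX.
  apply: measurable_funB => //.
  exact: (measurable_gmean_param mu beta_gt0 mg i mY (mY i)).
- by move=> w _; rewrite lee_fin sumr_ge0// => i _; rewrite sqr_ge0.
apply: (@le_trans _ _ (n%:R^-1%:E * (\sum_(i < n)
    (lincomb phi lambda (x i) - f (x i)) ^+ 2 + beta * K)%:E)%E).
  by rewrite lee_wpmul2l// lee_fin invr_ge0 ltW.
rewrite -EFinM lee_fin /sqnorm_dist mulrDr -addrA lerD2l.
have := ln_shift_cost_le lambda tau_gt0.
(* As [tau^-1 = Num.sqrt tr / sigma], the argument of [log_plus] takes its final form. *)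
rewrite -/C (_ : _ / _ * _ =
    Num.sqrt tr / ((nb_nonzero lambda)%:R * sigma) * l1norm lambda); last first.
  by rewrite tauE invf_div invfM; ring.
set N := (nb_nonzero lambda)%:R; set B := 1 + log_plus _ => lnC.
rewrite [leLHS](_ : _ = (beta * ln C + sigma ^+ 2) / n%:R); last first.
  by rewrite /K; field; rewrite !gt_eqF.
rewrite [leRHS](_ : _ = (beta * (4 * N * B) + sigma ^+ 2) / n%:R); last by ring.
by rewrite ler_pM2r ?invr_gt0// lerD2r ler_pM2l.
Qed.
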